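(* Let $K$ be a field of characteristic $0$ and let $\mathcal{O}=\{t_1,\dots,t_\mu\}\subseteq\mathbb{T}^2$ be an order ideal with border $\partial\mathcal{O}=\{b_1,\dots,b_\nu\}$. Let $\mathbb{B}_{\mathcal{O}}=\operatorname{Spec}(K[\mathbf{c}]/I(\mathbb{B}_{\mathcal{O}}))\subseteq\mathbb{A}^{\mu\nu}$, with $I(\mathbb{B}_{\mathcal{O}})=(\rho^{1,2}_{pq}\mid 1\le p,q\le\mu)$, be the $\mathcal{O}$-border basis scheme. Then the ideal $I(\mathbb{B}_{\mathcal{O}})$ is generated by the $\rho^{1,2}_{pq}$ that are neither trivially $0$ nor extreme, and the number of these is $(\nu-2)\mu$. Consequently, $\mathbb{B}_{\mathcal{O}}$ is a complete intersection in $\operatorname{Spec}(K[\mathbf{c}])=\mathbb{A}^{\mu\nu}$.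
   Context: Let $\mathbb{T}^2=\{x_1^{\alpha_1}x_2^{\alpha_2}\mid\alpha_1,\alpha_2\ge 0\}$. An order ideal is a finite set $\mathcal{O}=\{t_1,\dots,t_\mu\}\subseteq\mathbb{T}^2$ of $\mu$ distinct monomials such that every monomial dividing some $t_i$ lies in $\mathcal{O}$. Its border is $\partial\mathcal{O}=(x_1\mathcal{O}\cup x_2\mathcal{O})\setminus\mathcal{O}=\{b_1,\dots,b_\nu\}$. Let $\mathbf{c}=\{c_{ij}\mid 1\le i\le\mu,\ 1\le j\le\nu\}$ be indeterminates. The generic multiplication matrices $\mathcal{A}_k=(\xi^k_{rs})$, $k=1,2$, are the $\mu\times\mu$ matrices over $K[\mathbf{c}]$ given by: $\xi^k_{rs}=1$ if $x_kt_s=t_r$; $\xi^k_{rs}=0$ if $x_kt_s\in\mathcal{O}$ and $x_kt_s\neq t_r$; $\xi^k_{rs}=c_{rj}$ if $x_kt_s=b_j\in\partial\mathcal{O}$. The polynomial $\rho^{1,2}_{pq}\in K[\mathbf{c}]$ is the $(p,q)$-entry of the commutator $[\mathcal{A}_1,\mathcal{A}_2]=\mathcal{A}_1\mathcal{A}_2-\mathcal{A}_2\mathcal{A}_1$. The $\rho$'s are counted by their index pairs $(p,q)$. $\rho^{1,2}_{pq}$ is called trivially $0$ if $x_1t_q\in\mathcal{O}$ and $x_2t_q\in\mathcal{O}$ (it is then the zero polynomial). $\rho^{1,2}_{pq}$ is called extreme if the arrow from $t_p$ to $x_1x_2t_q$ is in extreme position and is $(1,2)$-good, that is: $t_p=x_2^u$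 for some $u\ge 0$; $x_2t_q\notin\mathcal{O}$; and both components of the displacement vector (exponent vector of $x_1x_2t_q$ minus exponent vector of $t_p$) are positive. Complete intersection in $\mathbb{A}^{\mu\nu}$ means that the ideal is generated by a number of elements equal to the codimension of $\mathbb{B}_{\mathcal{O}}$ in $\mathbb{A}^{\mu\nu}$. *)

(* Defs.v *)
From HB Require Import structures.
From mathcomp Require Import all_boot all_order all_algebra.
From mathcomp Require Import mpoly.

Set Implicit Arguments.
Unset Strict Implicit.
Unset Printing Implicit Defensive.

Import GRing.Theory.

Local Open Scope ring_scope.

(* Ideals of a general ring have no decidable membership, so they are Prop
   predicates here; primes are the bundled [prime_idealr] of ring_quotient
   (proper, prime), which under classical logic are all the prime ideals. *)
Section Ideals.
Variable R : comNzRingType.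

Definition gen_ideal (I : finType) (P : pred I) (f : I -> R) (x : R) : Prop :=
  exists a : I -> R, x = \sum_(i | P i) a i * f i.

Definition same_ideal (A B : R -> Prop) : Prop := forall x, A x <-> B x.

Definition proper_sub (P Q : prime_idealr R) : Prop :=
  {subset P <= Q} /\ exists2 x, x \in Q & x \notin P.

(* height P >= n: there is a chain C 0 < C 1 < ... < C n = P of primes. *)
Definition height_ge (P : prime_idealr R) (n : nat) : Prop :=
  exists C : nat -> prime_idealr R,
    (forall i, (i < n)%N -> proper_sub (C i) (C i.+1)) /\ C n =i P.

Definition prime_over (A : R -> Prop) (P : prime_idealr R) : Prop :=
  forall x, A x -> x \in P.

(* The codimension of Spec (R / A) in Spec R, i.e. the infimum of the heights
   of the primes containing A, exists and is equal to n. *)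
Definition has_codim (A : R -> Prop) (n : nat) : Prop :=
  (forall P, prime_over A P -> height_ge P n) /\
  (exists2 P, prime_over A P & ~ height_ge P n.+1).

Definition complete_intersection (A : R -> Prop) : Prop :=
  exists (n : nat) (g : 'I_n -> R),
    has_codim A n /\ same_ideal A (gen_ideal xpredT g).

End Ideals.

Definition x1 : 'I_2 := ord0.
Definition x2 : 'I_2 := ord_max.

(* In multi_scope, [m <= m'] is divisibility of monomials. *)
Definition order_ideal (mu : nat) (t : mu.-tuple 'X_{1..2}) : Prop :=
  uniq t /\ forall m m' : 'X_{1..2}, m' \in t -> (m <= m')%MM -> m \in t.

Definition border (mu : nat) (t : mu.-tuple 'X_{1..2}) : seq 'X_{1..2} :=
  [seq m <- [seq (U_(x1) + s)%MM | s <- t] ++ [seq (U_(x2) + s)%MM | s <- t]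
     | m \notin t].

Definition is_border (mu nu : nat) (t : mu.-tuple 'X_{1..2})
    (b : nu.-tuple 'X_{1..2}) : Prop :=
  uniq b /\ b =i border t.

Section BorderBasisScheme.
Variables (K : fieldType) (mu nu : nat).
Variables (t : mu.-tuple 'X_{1..2}) (b : nu.-tuple 'X_{1..2}).

Local Notation Kc := {mpoly K[mu * nu]}.

Definition indet (i : 'I_mu) (j : 'I_nu) : Kc := 'X_(mxvec_index i j).

(* When b enumerates the border of t, the final [0] is never reached. *)
Definition mult_mx (k : 'I_2) : 'M[Kc]_mu :=
  \matrix_(r, s)
    let m := (U_(k) + tnth t s)%MM in
    if m == tnth t r then 1
    else if m \in t then 0
    else if [pick j | tnth b j == m] is Some j then indet r j
    else 0.

Definition rho (pq : 'I_mu * 'I_mu) : Kc :=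
  (mult_mx x1 *m mult_mx x2 - mult_mx x2 *m mult_mx x1) pq.1 pq.2.

Definition trivially_zero (pq : 'I_mu * 'I_mu) : bool :=
  ((U_(x1) + tnth t pq.2)%MM \in t) && ((U_(x2) + tnth t pq.2)%MM \in t).

(* The first conjunct says that t_p is a power of x2. *)
Definition extreme (pq : 'I_mu * 'I_mu) : bool :=
  let tp := tnth t pq.1 in
  let x1x2tq := (U_(x1) + U_(x2) + tnth t pq.2)%MM in
  [&& tp == (U_(x2) *+ tp x2)%MM,
      (U_(x2) + tnth t pq.2)%MM \notin t,
      (tp x1 < x1x2tq x1)%N & (tp x2 < x1x2tq x2)%N].

Definition border_basis_ideal : Kc -> Prop := gen_ideal xpredT rho.

Definition kept : pred ('I_mu * 'I_mu) :=
  fun pq => ~~ trivially_zero pq && ~~ extreme pq.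

End BorderBasisScheme.

Arguments indet K {mu nu} i j.
Arguments mult_mx K {mu nu} t b k.
Arguments rho K {mu nu} t b pq.
Arguments border_basis_ideal K {mu nu} t b _.

(* Main.v *)
(**
Generation.  Put C = [A1, A2].  For W = sum_i A2^(l-i) A1^k A2^i the trace of
W C vanishes identically, because W is the noncommutative derivative of
A1^k A2^(l+1) up to cyclic permutation.  If t_q is the top of column k, with
x2-exponent l + u, the entry of C at (x2^u, t_q) occurs in this relation with
coefficient l + 1, which is invertible in characteristic 0, and the other
extreme entries that occur are in rows x2^u' with u' > u; descending induction
on u expresses the extreme entries through the others.

Codimension, lower bound.  At every point of the scheme with values in a field
F, the matrices commute and 1 is a cyclic vector.  Hence the commutant has
dimension at most mu, and dually the map (X1, X2) -> [X1, A2] + [A1, X2] has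
corank at most mu; since the tangent space meets the tangents ([Y, A1], [Y, A2])
of the conjugation orbit trivially, the Jacobian of the rho's has rank at least
mu nu - 2 mu.  The rank of the gradients of the elements of a prime ideal P,
taken at the generic point of P, never exceeds the height of P.

Codimension, upper bound.  All rho's vanish at the origin.  If g_1, ..., g_n
vanish at the origin of affine N-space, some set S of at least N - n variables
is algebraically independent modulo (g_1, ..., g_n): otherwise the standard
monomials of degree at most M number O(M^(N-n-1)), their products with the
monomials of degree at most M in the g_i span the polynomials modulo order
M + 1, and there are too few of them.  A prime that is maximal among the
ideals that contain the g_i and meet K[S] in 0 has height at most n,
because a chain of h primes below it yields |S| + h algebraically independent
polynomials in N variables.
*)

Require Import Defs.
From HB Require Import structures.
From mathcomp Require Import all_boot all_order all_algebra.
From mathcomp Require Import mpoly.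
From mathcomp Require Import zify.
From mathcomp Require classical_sets boolp.
Set Implicit Arguments.
Unset Strict Implicit.
Unset Printing Implicit Defensive.

Import Order.TTheory GRing.Theory.

Local Open Scope ring_scope.

(** * Gradients and heights of primes *)

Definition resdom (R : comNzRingType) (P : prime_idealr R) := {ideal_quot P}.

Section ResidueDomain.
Variables (R : comNzRingType) (P : prime_idealr R).

HB.instance Definition _ := GRing.ComNzRing.on (resdom P).

(** An integral domain structure carries an inverse function, so invertibility in the quotient is
    decided classically and inverses are chosen. *)
Definition resdom_unit (x : resdom P) : bool :=
  boolp.asbool (exists y, y * x = 1).

Definition resdom_inv (x : resdom P) : resdom P :=
  match boolp.pselect (exists y, y * x = 1) with
  | left e => projT1 (boolp.cid e)
  | right _ => x
  end.

Fact resdom_mulVr : {in resdom_unit, left_inverse 1 resdom_inv *%R}.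
Proof.
move=> x /boolp.asboolP ex; rewrite /resdom_inv.
by case: boolp.pselect => // e; case: boolp.cid.
Qed.

Fact resdom_unitP (x y : resdom P) : y * x = 1 -> resdom_unit x.
Proof. by move=> e; apply/boolp.asboolP; exists y. Qed.

Fact resdom_inv_out : {in [predC resdom_unit], resdom_inv =1 id}.
Proof.
by move=> x /boolp.asboolP ex; rewrite /resdom_inv; case: boolp.pselect.
Qed.

HB.instance Definition _ := GRing.ComNzRing_hasMulInverse.Build (resdom P)
  resdom_mulVr resdom_unitP resdom_inv_out.
HB.instance Definition _ := GRing.ComUnitRing_isIntegral.Build (resdom P)
  (@Quotient.rquot_IdomainAxiom R P).

Definition resdom_pi (x : R) : resdom P := \pi_{ideal_quot P}%qT x.

HB.instance Definition _ := GRing.isZmodMorphism.Build R (resdom P) resdom_pi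
  (fun x y => rmorphB (\pi_{ideal_quot P}%qT : {rmorphism R -> _}) x y).
HB.instance Definition _ := GRing.isMonoidMorphism.Build R (resdom P) resdom_pi
  (rmorph1 (\pi_{ideal_quot P}%qT : {rmorphism R -> _}),
   rmorphM (\pi_{ideal_quot P}%qT : {rmorphism R -> _})).

Lemma resdom_pi_eq0 (x : R) : (resdom_pi x == 0) = (x \in P).
Proof.
by rewrite -[RHS]/(x \in (P : {pred R})) -[x in RHS]subr0 Quotient.idealrBE
           -(rmorph0 (\pi_{ideal_quot P}%qT : {rmorphism R -> _})).
Qed.

End ResidueDomain.

Section RingKernel.
Variables (R : comNzRingType) (D : idomainType) (phi : {rmorphism R -> D}).

Definition rker : {pred R} := fun x => phi x == 0.

Lemma in_rker x : (x \in rker) = (phi x == 0). Proof. by []. Qed.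

Fact rker_idealr : idealr_closed rker.
Proof.
split; rewrite ?in_rker ?rmorph0 ?rmorph1 ?oner_eq0 // => a u v.
by rewrite !in_rker rmorphD rmorphM => /eqP-> /eqP->; rewrite mulr0 addr0.
Qed.

Fact rker_prime : prime_idealr_closed rker.
Proof. by move=> u v; rewrite !in_rker rmorphM mulf_eq0. Qed.

HB.instance Definition _ := isIdealr.Build R rker rker_idealr.
HB.instance Definition _ := isPrimeIdealrClosed.Build R rker rker_prime.

End RingKernel.

Lemma prime_residue_field (R : comNzRingType) (P : prime_idealr R) :
  exists (F : fieldType) (phi : {rmorphism R -> F}),
    forall x, (x \in P) = (phi x == 0).
Proof.
exists {fraction resdom P}, (@FracField.tofrac _ \o @resdom_pi R P) => x.
by rewrite -resdom_pi_eq0 /= tofrac_eq0.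
Qed.

Section Height.
Variable R : comNzRingType.
Implicit Types P Q : prime_idealr R.

Lemma height_ge0 P : height_ge P 0.
Proof. by exists (fun _ => P). Qed.

Lemma eq_height_ge P Q n : P =i Q -> height_ge P n -> height_ge Q n.
Proof. by move=> PQ [C [C_ CP]]; exists C; split=> // x; rewrite CP PQ. Qed.

Lemma height_geS P Q n : Defs.proper_sub P Q -> height_ge P n -> height_ge Q n.+1.
Proof.
move=> [PQ [x xQ xP]] [C [C_ CP]].
exists (fun i => if (i <= n)%N then C i else Q); split; last by rewrite ltnn.
move=> i; rewrite ltnS => le_in /=; rewrite le_in.
move: le_in; rewrite [(i <= n)%N]leq_eqVlt => /orP[/eqP->|lt_in]; last first.
  by rewrite lt_in; apply: C_.
rewrite ltnn; split=> [y|]; first by rewrite CP; apply: PQ.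
by exists x; rewrite ?CP.
Qed.

Lemma height_geW P m n : (m <= n)%N -> height_ge P n -> height_ge P m.
Proof.
move=> le_mn [C [C_ CP]]; exists (fun i => C (n - m + i)%N).
split=> [i lt_im|]; last by rewrite subnK.
by rewrite addnS; apply: C_; rewrite -[ltnRHS](subnK le_mn) ltn_add2l.
Qed.

End Height.

Section PolyPrime.
Variables (A : comNzRingType) (P : prime_idealr A).

(** The extension [P[X]], encoded as the kernel of coefficientwise reduction to the domain [A/P],
    which makes primality immediate. *)
Definition polyprime : prime_idealr {poly A} := rker (map_poly (@resdom_pi A P)).

Lemma polyprimeP (f : {poly A}) :
  reflect (forall i, f`_i \in P) (f \in polyprime).
Proof.
rewrite /polyprime in_rker; apply: (iffP eqP) => [f0 i|fP].
  by rewrite -resdom_pi_eq0 -coef_map /= f0 coef0.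
by apply/polyP=> i; rewrite coef_map coef0 /=; apply/eqP; rewrite resdom_pi_eq0.
Qed.

End PolyPrime.

Lemma height_ge_polyprime (A : comNzRingType) (P : prime_idealr A) n :
  height_ge P n -> height_ge (polyprime P) n.
Proof.
move=> [C [C_ CP]]; exists (fun i => polyprime (C i)); split=> [i lt_in|f].
  have [sub [x xS xN]] := C_ i lt_in; split=> [f /polyprimeP fC|].
    by apply/polyprimeP=> j; apply/sub/fC.
  exists x%:P; last by apply/polyprimeP=> /(_ 0%N); rewrite coefC (negPf xN).
  by apply/polyprimeP=> -[|j]; rewrite coefC ?rpred0.
by apply/polyprimeP/polyprimeP => fP i; rewrite ?CP // -CP.
Qed.

Lemma height_ge_iso (A B : comNzRingType) (f : {rmorphism A -> B})
    (P : prime_idealr A) (Q : prime_idealr B) n :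
  bijective f -> (forall x, (f x \in Q) = (x \in P)) -> height_ge Q n ->
  height_ge P n.
Proof.
move=> [g fK gK] fQP [C [C_ CQ]].
pose C' i : prime_idealr A := rker (@resdom_pi B (C i) \o f).
have C'E i x : (x \in C' i) = (f x \in C i) by rewrite in_rker /= resdom_pi_eq0.
exists C'; split=> [i lt_in|x]; last by rewrite C'E CQ fQP.
have [sub [x xS xN]] := C_ i lt_in.
split=> [y|]; first by rewrite !C'E; apply: sub.
by exists (g x); rewrite !C'E gK.
Qed.

(** * Derivations into a field and gradients *)

Section Derivations.
Variables (A : comNzRingType) (F : fieldType) (phi : A -> F).

Definition derivation_along (d : A -> F) : Prop :=
  (forall x y, d (x + y) = d x + d y) /\
  (forall x y, d (x * y) = phi x * d y + phi y * d x).

Variables (m : nat) (d : 'I_m -> A -> F).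
Hypothesis d_der : forall i, derivation_along (d i).

Definition gradient (x : A) : 'rV[F]_m := \row_i d i x.

Lemma gradientD x y : gradient (x + y) = gradient x + gradient y.
Proof. by apply/rowP=> i; rewrite !mxE (d_der i).1. Qed.

Lemma gradientM x y :
  gradient (x * y) = phi x *: gradient y + phi y *: gradient x.
Proof. by apply/rowP=> i; rewrite !mxE (d_der i).2. Qed.

Lemma gradient0 : gradient 0 = 0.
Proof. by apply: (addrI (gradient 0)); rewrite -gradientD !addr0. Qed.

Lemma gradient_sum (I : Type) (r : seq I) (E : I -> A) :
  gradient (\sum_(i <- r) E i) = \sum_(i <- r) gradient (E i).
Proof. exact: (big_morph _ gradientD gradient0). Qed.

End Derivations.

(** The rank is bounded through the number of rows of [W], so that in an induction a longer chain of
    primes is matched by one more row. *)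
Definition gradients_bound_height (A : comNzRingType) : Prop :=
  forall (F : fieldType) (phi : {rmorphism A -> F}) m (d : 'I_m -> A -> F)
    (P : prime_idealr A),
  (forall i, derivation_along phi (d i)) -> P =i rker phi ->
  exists n (W : 'M[F]_(n, m)),
    height_ge P n /\ {in P, forall x, (gradient d x <= W)%MS}.

(* The residue field of [P] over that of its contraction to [A] costs one more
   gradient exactly when [P] is larger than the extension of its contraction;
   pseudo-division by an element of least degree in the difference shows that
   one gradient is then enough. *)
Lemma gradients_bound_height_poly (A : idomainType) :
  gradients_bound_height A -> gradients_bound_height {poly A}.
Proof.
move=> hA F phi m d P d_der PE.
pose phi0 : {rmorphism A -> F} := phi \o polyC.
pose p : prime_idealr A := rker phi0.
have d0_der i : derivation_along phi0 (d i \o polyC).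
  by split=> x y /=; rewrite ?polyCD ?polyCM ?(d_der i).1 ?(d_der i).2.
have [n [W [hp Wp]]] := hA F phi0 m (fun i => d i \o polyC) p d0_der (fun=> erefl).
have phiE f : phi f = \sum_(i < size f) phi0 f`_i * phi 'X ^+ i.
  rewrite -{1}[f]coefK poly_def rmorph_sum; apply: eq_bigr => i _.
  by rewrite -mul_polyC rmorphM rmorphXn.
have pP : {subset polyprime p <= P}.
  move=> f /polyprimeP fp; rewrite PE in_rker phiE big1 // => i _.
  by have := fp i; rewrite in_rker => /eqP->; rewrite mul0r.
have grad_pp f : f \in polyprime p -> (gradient d f <= W)%MS.
  move=> /polyprimeP fp; rewrite -[f]coefK poly_def (gradient_sum d_der).
  apply: summx_sub => i _; rewrite -mul_polyC (gradientM d_der).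
  have := fp i; rewrite in_rker => /eqP /= ->; rewrite scale0r add0r.
  by apply: scalemx_sub; apply: Wp.
have [Pp|] := boolp.pselect {subset P <= polyprime p}.
  exists n, W; split=> [|f /Pp]; last exact: grad_pp.
  apply: eq_height_ge (height_ge_polyprime hp) => f.
  by apply/idP/idP; [apply: pP | apply: Pp].
move=> Pp.
pose small k := boolp.asbool
  (exists f, [/\ f \in P, f \notin polyprime p & size f = k]).
have ex_small : exists k, small k.
  apply: boolp.contrapT => no; apply: Pp => f fP; apply: boolp.contrapT => fp.
  apply: no; exists (size f); apply/boolp.asboolP; exists f.
  by split=> //; apply/negP.
have [k /boolp.asboolP[f [fP fp sf]] fmin] := ex_minnP ex_small.
have {}fmin g : g \in P -> (size g < size f)%N -> g \in polyprime p.
  move=> gP; apply: contraTT => gp; rewrite -leqNgt sf; apply: fmin.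
  by apply/boolp.asboolP; exists g.
have f0 : f != 0 by apply: contraNneq fp => ->; rewrite rpred0.
(* Otherwise removing the leading term leaves a shorter element of [P], hence one of [polyprime p],
   and [f] itself would lie there. *)
have lfp : lead_coef f \notin p.
  apply: contra fp => lfp.
  have lfX : lead_coef f *: 'X^((size f).-1) \in polyprime p.
    apply/polyprimeP=> i; rewrite coefZ coefXn mulrC.
    exact: (@idealMr _ p).
  rewrite -[f](subrK (lead_coef f *: 'X^((size f).-1))) rpredD //.
  apply: fmin; first by rewrite rpredB // pP.
  have sf0 : (0 < size f)%N by rewrite size_poly_gt0.
  rewrite -[ltnRHS](prednK sf0) ltnS; apply/leq_sizeP => j.
  rewrite leq_eqVlt coefB coefZ coefXn => /orP[/eqP<-|lt_j].
    by rewrite eqxx mulr1 lead_coefE subrr.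
  by rewrite gtn_eqF // mulr0 subr0 nth_default // -(prednK sf0).
exists (n + 1)%N, (col_mx W (gradient d f)); split.
  rewrite addn1; apply: height_geS (height_ge_polyprime hp); split=> //.
  by exists f.
move=> g gP.
pose a := lead_coef f ^+ Pdiv.IdomainDefs.scalp g f.
have phia0 : phi0 a != 0.
  by rewrite rmorphXn expf_neq0 //; apply: contra lfp; rewrite in_rker.
have div : a%:P * g = (g %/ f)%R * f + (g %% f)%R.
  by rewrite mul_polyC; apply: Pdiv.Idomain.divp_eq.
have gP0 : phi g = 0 by apply/eqP; rewrite -in_rker -PE.
have fP0 : phi f = 0 by apply/eqP; rewrite -in_rker -PE.
have rp : (g %% f)%R \in polyprime p.
  apply: fmin; last by rewrite ltn_modp.
  rewrite PE in_rker; have := congr1 phi div.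
  by rewrite rmorphD !rmorphM gP0 fP0 !mulr0 add0r => <-.
(* Since [f] and [g] vanish at the point, the product rule expresses [phi0 a] times the gradient of
   [g] by the gradients of [f] and of the remainder. *)
have := congr1 (gradient d) div.
rewrite (gradientD d_der) !(gradientM d_der) gP0 fP0 !scale0r !addr0 => ga.
suff : (phi a%:P *: gradient d g <= col_mx W (gradient d f))%MS.
  by move=> /(scalemx_sub (phi0 a)^-1); rewrite scalerA mulVf // scale1r.
rewrite ga addmx_sub //.
  by apply: scalemx_sub; rewrite -addsmxE addsmxSr.
by rewrite -addsmxE (submx_trans (grad_pp _ rp)) // addsmxSl.
Qed.

Lemma gradients_bound_height_iso (A B : comNzRingType)
    (f : {rmorphism A -> B}) (g : {rmorphism B -> A}) :
  cancel f g -> cancel g f ->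
  gradients_bound_height B -> gradients_bound_height A.
Proof.
move=> fK gK hB F phi m d P d_der PE.
have dg_der i : derivation_along (phi \o g) (d i \o g).
  by split=> x y /=; rewrite ?rmorphD ?rmorphM ?(d_der i).1 ?(d_der i).2.
have [n [W [hQ QW]]] :=
  hB F (phi \o g) m _ (rker (phi \o g)) dg_der (fun=> erefl).
exists n, W; split=> [|x xP].
  apply: height_ge_iso hQ; first by exists g; [apply: fK | apply: gK].
  by move=> x; rewrite PE !in_rker /= fK.
have := QW (f x); rewrite in_rker /= fK -in_rker -PE => /(_ xP).
by congr (_ <= _)%MS; apply/rowP=> i; rewrite !mxE /= fK.
Qed.

(** * Polynomials in one more variable as univariate polynomials *)

Section MPolyPoly.
Variables (K : fieldType) (N : nat).

Definition mpoly_of_poly : {poly {mpoly K[N]}} -> {mpoly K[N.+1]} :=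
  horner_eval 'X_ord_max \o map_poly (@mwiden N K).

HB.instance Definition _ := GRing.RMorphism.on mpoly_of_poly.

Lemma mpoly_of_polyE p :
  mpoly_of_poly p = \sum_(i < size p) mwiden p`_i * 'X_ord_max ^+ i.
Proof.
rewrite -{1}[p]coefK poly_def rmorph_sum; apply: eq_bigr => i _.
rewrite -mul_polyC rmorphM rmorphXn /= /mpoly_of_poly /= /horner_eval map_polyC map_polyX.
by rewrite hornerC hornerX.
Qed.

Lemma mwidenX_restrict (m : 'X_{1..N.+1}) :
  mwiden 'X_[[multinom m (widen_ord (leqnSn N) i) | i < N]]
    * 'X_ord_max ^+ m ord_max = 'X_[m] :> {mpoly K[N.+1]}.
Proof.
rewrite mwidenX mpolyXn -mpolyXD; congr 'X_[_].
apply/mnmP => j; rewrite mnmDE mulmnE mnm1E.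
case: (unliftP ord_max j) => [i|] ->.
  rewrite (negPf (neq_lift _ _)) mul0n addn0.
  have -> : lift ord_max i = widen_ord (leqnSn N) i.
    by apply: val_inj; rewrite /= /bump leqNgt ltn_ord.
  by rewrite mnmwiden_widen mnmE.
by rewrite eqxx mul1n mnmwiden_ordmax.
Qed.

Lemma muniK : cancel (@muni N K) mpoly_of_poly.
Proof.
move=> f; rewrite muniE rmorph_sum [RHS]mpolyE; apply: eq_bigr => m _.
rewrite -!mul_polyC !rmorphM rmorphXn /= /mpoly_of_poly /horner_eval /=.
rewrite !map_polyC map_polyX hornerX !hornerC /= mwidenZ -scalerAl.
by rewrite mwidenX_restrict.
Qed.

Lemma muni_mwiden (f : {mpoly K[N]}) : muni (mwiden f) = f%:P.
Proof.
rewrite [in LHS](mpolyE f) [in RHS](mpolyE f).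
rewrite (raddf_sum (@mwiden N K)) (raddf_sum (@muni N K)) raddf_sum.
apply: eq_bigr => m _ /=; rewrite mwidenZ mwidenX muniZ.
rewrite muniE msuppX big_seq1 mcoeffX eqxx scale1r mnmwiden_ordmax expr0.
rewrite alg_polyC -mul_polyC -polyCM mul_mpolyC; congr (_ *: 'X_[_])%:P.
by apply/mnmP=> i; rewrite mnmE mnmwiden_widen.
Qed.

Lemma mpoly_of_polyK : cancel mpoly_of_poly (@muni N K).
Proof.
move=> p; rewrite mpoly_of_polyE rmorph_sum -[RHS]coefK poly_def.
apply: eq_bigr => i _; rewrite rmorphM rmorphXn /= muni_mwiden mul_polyC.
congr (_ *: _ ^+ i); rewrite muniE msuppX big_seq1 mcoeffX eqxx scale1r.
rewrite mnm1E eqxx expr1 [X in 'X_[X]](_ : _ = 0%MM) ?mpolyX0 ?scale1r //.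
apply/mnmP=> j; rewrite mnmE mnm1E mnm0E eq_sym.
by rewrite -val_eqE /= ltn_eqF.
Qed.

End MPolyPoly.

Lemma gradients_bound_height_mpoly (K : fieldType) N :
  gradients_bound_height {mpoly K[N]}.
Proof.
elim: N => [|N IHN] F phi m d P d_der PE.
  exists 0%N, 0; split; first exact: height_ge0.
  (* Without variables every element is a constant, and a nonzero constant is a unit. *)
  move=> f; rewrite PE in_rker (nvar0_mpolyC f); set c := f@_0.
  have [->|c0] := eqVneq c 0; first by rewrite mpolyC0 (gradient0 d_der) sub0mx.
  move=> /eqP phic; suff : phi 1 == 0 by rewrite rmorph1 oner_eq0.
  by rewrite -[1]mpolyC1 -(mulVf c0) mpolyCM rmorphM phic mulr0.
exact: (@gradients_bound_height_iso {mpoly K[N.+1]} {poly {mpoly K[N]}}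
  (@muni N K) (@mpoly_of_poly K N) (@muniK K N) (@mpoly_of_polyK K N)
  (gradients_bound_height_poly IHN) F phi m d P d_der PE).
Qed.

(** * Heights and algebraically independent variables *)

Section MonomialSupport.
Variables (N : nat) (K : fieldType).
Implicit Types (f g : {mpoly K[N]}) (Q : 'X_{1..N} -> Prop).

Definition supported Q f : Prop := forall m, m \in msupp f -> Q m.

Lemma supported0 Q : supported Q 0. Proof. by move=> m; rewrite msupp0. Qed.

Lemma supportedD Q f g : supported Q f -> supported Q g -> supported Q (f + g).
Proof.
move=> fQ gQ m mfg; have := msuppD_le mfg; rewrite mem_cat.
by case/orP; [apply: fQ | apply: gQ].
Qed.

Lemma supportedZ Q c f : supported Q f -> supported Q (c *: f).
Proof. by move=> fQ m /msuppZ_le; apply: fQ. Qed.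

Lemma supportedX Q m : Q m -> supported Q 'X_[m].
Proof. by move=> Qm x; rewrite msuppX inE => /eqP->. Qed.

Lemma supported_sum Q (I : Type) (r : seq I) (P : pred I) (F : I -> {mpoly K[N]}) :
  (forall i, P i -> supported Q (F i)) -> supported Q (\sum_(i <- r | P i) F i).
Proof.
by move=> FQ; elim/big_ind: _; [apply: supported0 | apply: supportedD | ].
Qed.

Lemma supportedM Q1 Q2 Q f g :
  (forall m1 m2, Q1 m1 -> Q2 m2 -> Q (m1 + m2)%MM) ->
  supported Q1 f -> supported Q2 g -> supported Q (f * g).
Proof.
move=> Q12 fQ gQ m /msuppM_le/allpairsP[[m1 m2] /= [m1f m2g ->]].
by apply: Q12; [apply: fQ | apply: gQ].
Qed.

Definition in_vars (S : {set 'I_N}) f : Prop :=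
  supported (fun m => forall i, i \notin S -> m i = 0%N) f.

Lemma in_varsM S f g : in_vars S f -> in_vars S g -> in_vars S (f * g).
Proof.
by apply: supportedM => m1 m2 m1S m2S i iS; rewrite mnmDE m1S ?m2S.
Qed.

Lemma in_vars1 S : in_vars S 1.
Proof. by rewrite -mpolyX0; apply: supportedX => i; rewrite mnm0E. Qed.

(** The variables in [S] are algebraically independent modulo [A]. *)
Definition alg_free (S : {set 'I_N}) (A : {mpoly K[N]} -> Prop) : Prop :=
  forall f, A f -> in_vars S f -> f = 0.

(** Exponent boxes are finite types with an explicit cardinal. They contain the monomials of degree
    at most [B] and lie in degree at most [N * B], which suffices for asymptotic counts. *)
Definition box_mnm (B : nat) (e : {ffun 'I_N -> 'I_B.+1}) : 'X_{1..N} :=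
  [multinom e i : nat | i < N].

Lemma box_mnm_inj B : injective (@box_mnm B).
Proof.
move=> e e' /mnmP ee'; apply/ffunP=> i; apply: val_inj.
by have := ee' i; rewrite !mnmE.
Qed.

Lemma leq_mnm_mdeg (m : 'X_{1..N}) i : (m i <= mdeg m)%N.
Proof. by rewrite mdegE (bigD1 i) //= leq_addr. Qed.

Lemma box_mnmP B (m : 'X_{1..N}) :
  (mdeg m <= B)%N -> exists e : {ffun 'I_N -> 'I_B.+1}, box_mnm e = m.
Proof.
move=> mB; exists [ffun i => inord (m i)]; apply/mnmP => i.
by rewrite mnmE ffunE inordK // ltnS (leq_trans (leq_mnm_mdeg m i)).
Qed.

Lemma mdeg_box_mnm B (e : {ffun 'I_N -> 'I_B.+1}) :
  (mdeg (box_mnm e) <= N * B)%N.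
Proof.
rewrite mdegE -[N in (N * B)%N]card_ord -sum_nat_const; apply: leq_sum => i _.
by rewrite mnmE -ltnS.
Qed.

Definition coef_box (B : nat) f : 'rV[K]_#|{ffun 'I_N -> 'I_B.+1}| :=
  \row_e f@_(box_mnm (enum_val e)).

Lemma coef_box_is_linear B : linear (@coef_box B).
Proof. by move=> c f g; apply/rowP=> e; rewrite !mxE mcoeffD mcoeffZ. Qed.

HB.instance Definition _ B := GRing.isLinear.Build K {mpoly K[N]}
  'rV[K]_#|{ffun 'I_N -> 'I_B.+1}| _ (@coef_box B) (@coef_box_is_linear B).

Lemma coef_box_inj B f :
  supported (fun m => mdeg m <= B)%N f -> coef_box B f = 0 -> f = 0.
Proof.
move=> fB f0; apply/mpolyP=> m; rewrite mcoeff0.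
have [mf|/memN_msupp_eq0//] := boolP (m \in msupp f).
have [e <-] := box_mnmP (fB m mf).
by have /rowP/(_ (enum_rank e)) := f0; rewrite !mxE enum_rankK.
Qed.

Lemma card_box B : #|{ffun 'I_N -> 'I_B.+1}| = (B.+1 ^ N)%N.
Proof. by rewrite card_ffun !card_ord. Qed.

Lemma card_lin_indep (I : finType) (u : I -> {mpoly K[N]}) B :
  (forall i, supported (fun m => mdeg m <= B)%N (u i)) ->
  (forall c : I -> K, \sum_i c i *: u i = 0 -> forall i, c i = 0) ->
  (#|I| <= B.+1 ^ N)%N.
Proof.
move=> uB u_free; pose U := \matrix_(i < #|I|) coef_box B (u (enum_val i)).
suff /eqP <- : row_free U by rewrite -card_box rank_leq_col.
apply: inj_row_free => v vU0; apply/rowP=> i; rewrite mxE.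
rewrite -[i]enum_valK; apply: (u_free (fun x => v 0 (enum_rank x))).
apply: (@coef_box_inj B).
  by apply: supported_sum => x _; apply: supportedZ.
rewrite linear_sum /= -[RHS]vU0 mulmx_sum_row (reindex (@enum_val I I)) /=.
  by apply: eq_bigr => j _; rewrite linearZ rowK enum_valK.
by exists enum_rank => x _; rewrite ?enum_valK ?enum_rankK.
Qed.

End MonomialSupport.

Section HeightUpperBound.
Variables (N : nat) (K : fieldType).
Local Notation R := {mpoly K[N]}.
Implicit Types P Q : prime_idealr R.

Definition indep_mod P (I : finType) (u : I -> R) : Prop :=
  forall c : I -> K, \sum_i c i *: u i \in P -> forall i, c i = 0.

(** Modulo [Q] only the terms without a factor [f] survive, so their coefficients vanish; what
    remains is divisible by [f], which cancels modulo the prime [P], and the argument repeats. *)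
Lemma indep_mod_mul P Q f L (I : finType) (u : I -> R) :
  {subset P <= Q} -> f \in Q -> f \notin P -> indep_mod Q u ->
  indep_mod P (fun ki : 'I_L * I => f ^+ ki.1 * u ki.2).
Proof.
move=> PQ fQ fP u_free c.
have -> : \sum_ki c ki *: (f ^+ ki.1 * u ki.2)
    = \sum_(k < L) f ^+ k * \sum_i c (k, i) *: u i.
  under [RHS]eq_bigr => k _ do rewrite mulr_sumr.
  by rewrite pair_bigA; apply: eq_bigr => -[k i] _ /=; rewrite scalerAr.
pose e (k : 'I_L) i := c (k, i); move=> cP [k i]; rewrite -/(e k i).
have {cP}: \sum_(k < L) f ^+ k * \sum_i e k i *: u i \in P by [].
elim: L {c} e k => [|L IHL] e k; first by case: k.
rewrite big_ord_recl expr0 mul1r.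
under [X in _ + X]eq_bigr => j _ do rewrite lift0 exprS -mulrA.
rewrite -mulr_sumr => eP.
have e0 : forall i, e ord0 i = 0.
  apply: u_free; have := PQ _ eP; rewrite rpredDr //.
  by rewrite prime_idealrM fQ.
move: eP; rewrite big1 ?add0r => [|j _]; last by rewrite e0 scale0r.
rewrite prime_idealrM (negPf fP) /= => /IHL {}IHL.
by case: (unliftP ord0 k) => [j|] ->.
Qed.

(** A lower bound [r] for the dimension of [R / P] in terms of growth: polynomials of degree [O(L)]
    span at least [L ^ r] dimensions modulo [P]. *)
Definition box_growth P r : Prop :=
  exists D, forall L, exists (I : finType) (u : I -> R),
    [/\ #|I| = (L ^ r)%N, indep_mod P u
      & forall i, supported (fun m => mdeg m <= L * D)%N (u i)].

Lemma supported_deg f : exists e, supported (fun m => mdeg m <= e)%N (f : R).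
Proof.
by exists (msize f) => m /msize_mdeg_lt/ltnW.
Qed.

Lemma supported_exp f e k : supported (fun m => mdeg m <= e)%N (f : R) ->
  supported (fun m => mdeg m <= k * e)%N (f ^+ k).
Proof.
move=> fe; elim: k => [|k IHk].
  by rewrite expr0 -mpolyX0; apply: supportedX; rewrite mdeg0.
rewrite exprS; apply: supportedM fe IHk => m1 m2 h1 h2.
by rewrite mdegD mulSn leq_add.
Qed.

Lemma box_growthS P Q r :
  Defs.proper_sub P Q -> box_growth Q r -> box_growth P r.+1.
Proof.
move=> [PQ [f fQ fP]] [D growth]; have [e fe] := supported_deg f.
exists (e + D)%N => L; have [I [u [cardI uQ uD]]] := growth L.
exists ('I_L * I)%type, (fun ki : 'I_L * I => f ^+ ki.1 * u ki.2); split.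
- by rewrite card_prod card_ord cardI expnS.
- exact: (indep_mod_mul PQ fQ fP uQ).
move=> [k i]; refine (supportedM _ (supported_exp fe) (uD i)) => m1 m2 h1 h2.
rewrite mdegD mulnDr leq_add //; apply: leq_trans h1 _.
by rewrite leq_mul2r ltnW ?orbT.
Qed.

Lemma box_growth_vars P S : alg_free S (fun f => f \in P) -> box_growth P #|S|.
Proof.
move=> Sfree; exists N => L; pose T := {i | i \in S}.
pose mono (e : {ffun T -> 'I_L}) :=
  [multinom if insub i is Some s then e s : nat else 0%N | i < N].
have mono_inj : injective mono.
  move=> e e' /mnmP ee'; apply/ffunP=> s; apply: val_inj.
  by have := ee' (val s); rewrite !mnmE valK.
exists {ffun T -> 'I_L}, (fun e => 'X_[mono e]); split.
- by rewrite card_ffun card_ord card_sig.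
- move=> c /Sfree c0 e; have /mpolyP/(_ (mono e)) : \sum_e c e *: 'X_[mono e] = 0 :> R.
    apply: c0; apply: supported_sum => e' _; apply: supportedZ.
    by apply: supportedX => i iS; rewrite mnmE insubN.
  rewrite raddf_sum /= mcoeff0 (bigD1 e) //= mcoeffZ mcoeffX eqxx mulr1.
  rewrite big1 ?addr0 // => e' ne; rewrite mcoeffZ mcoeffX.
  by rewrite (inj_eq mono_inj) (negPf ne) mulr0.
move=> e; apply: supportedX.
rewrite mdegE mulnC -[N in (N * L)%N]card_ord -sum_nat_const.
by apply: leq_sum => i _; rewrite mnmE; case: insub => // s; apply: ltnW.
Qed.

Lemma box_growth_leq P r : box_growth P r -> (r <= N)%N.
Proof.
move=> [D growth]; rewrite leqNgt; apply/negP => lt_Nr.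
(* As [L] exceeds [D.+1 ^ N], the number of available monomials, at most [(L * D.+1) ^ N], stays
   below [L ^ N.+1]. *)
pose L := (D.+1 ^ N).+1; have [I [u [cardI uP uD]]] := growth L.
have /(card_lin_indep uD) : forall c : I -> K, \sum_i c i *: u i = 0 ->
    forall i, c i = 0.
  by move=> c c0; apply: uP; rewrite c0 rpred0.
apply/negP; rewrite -ltnNge cardI.
apply: leq_trans (_ : (L ^ N.+1 <= _)%N); last by rewrite leq_pexp2l.
apply: leq_ltn_trans (_ : ((L * D.+1) ^ N < _)%N).
  have [N0|N0] := posnP N; first by rewrite N0.
  by rewrite leq_exp2r // mulnS -addn1 addnC leq_add2r.
by rewrite expnMn expnSr ltn_pmul2l ?expn_gt0.
Qed.

(** The growth exponent [#|S|] at the top of the chain rises by one with each step down, yet it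
    never exceeds [N]. *)
Lemma height_leq_free P S h :
  alg_free S (fun f => f \in P) -> height_ge P h -> (#|S| + h <= N)%N.
Proof.
move=> /box_growth_vars growth [C [C_ CP]].
suff: box_growth (C 0%N) (#|S| + h) by apply: box_growth_leq.
have: box_growth (C h) #|S|.
  have [D growthP] := growth; exists D => L.
  have [I [u [cardI uP uD]]] := growthP L; exists I, u; split=> // c cP.
  by apply: uP; rewrite -CP.
elim: h C_ #|S| {CP growth} => [|h IHh] C_ r; first by rewrite addn0.
move=> growth; rewrite addnS -addSn; apply: IHh => [i lt_ih|].
  by apply: C_; apply: ltnW.
exact: box_growthS (C_ h (ltnSn h)) growth.
Qed.

End HeightUpperBound.

(** * Height of an ideal with n generators at the origin *)

Section GenIdeal.
Variables (R : comNzRingType) (I : finType) (P : pred I) (f : I -> R).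

Lemma gen_ideal0 : gen_ideal P f 0.
Proof. by exists (fun=> 0); rewrite big1 // => i _; rewrite mul0r. Qed.

Lemma gen_idealD x y : gen_ideal P f x -> gen_ideal P f y -> gen_ideal P f (x + y).
Proof.
move=> [a ->] [a' ->]; exists (fun i => a i + a' i).
by rewrite -big_split; apply: eq_bigr => i _; rewrite mulrDl.
Qed.

Lemma gen_idealM c x : gen_ideal P f x -> gen_ideal P f (c * x).
Proof.
move=> [a ->]; exists (fun i => c * a i).
by rewrite mulr_sumr; apply: eq_bigr => i _; rewrite mulrA.
Qed.

Lemma gen_ideal_mem i : P i -> gen_ideal P f (f i).
Proof.
move=> Pi; exists (fun j => (j == i)%:R).
rewrite (bigD1 i) //= eqxx mul1r big1 ?addr0 // => j /andP[_ /negPf->].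
by rewrite mul0r.
Qed.

Lemma gen_idealS (Q : pred I) x :
  subpred P Q -> gen_ideal P f x -> gen_ideal Q f x.
Proof.
move=> PQ [a ->]; exists (fun i => if P i then a i else 0).
rewrite big_mkcond [RHS]big_mkcond; apply: eq_bigr => i _.
by case: ifPn => [/PQ->//|]; rewrite mul0r if_same.
Qed.

End GenIdeal.

Section StandardMonomials.
Variables (N : nat) (K : fieldType) (n : nat) (g : 'I_n -> {mpoly K[N]}).
Hypothesis g0 : forall i, (g i)@_0%MM = 0.
Local Notation R := {mpoly K[N]}.
Local Notation I := (gen_ideal xpredT g).

Lemma gen_ideal_coef0 f : I f -> f@_0%MM = 0.
Proof.
move=> [a ->]; rewrite -[LHS]/(mcoeff 0%MM _) raddf_sum big1 //= => i _.
by rewrite rmorphM /= g0 mulr0.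
Qed.

Lemma alg_free0 : alg_free set0 I.
Proof.
move=> f If fS; apply/mpolyP=> m; rewrite mcoeff0.
have [mf|/memN_msupp_eq0//] := boolP (m \in msupp f).
have -> : m = 0%MM by apply/mnmP=> i; rewrite mnm0E fS ?inE.
exact: gen_ideal_coef0.
Qed.

Section Reduction.
Variables (d : nat) (f : {set 'I_N} -> R).
Hypothesis fI : forall S : {set 'I_N}, #|S| = d.+1 ->
  [/\ I (f S), in_vars S (f S) & f S != 0].

(** The [f S] witness that any [d.+1] variables are dependent modulo the ideal. They need not form a
    Groebner basis: the count relies on the existence of remainders, not on their uniqueness. *)
Definition standard (m : 'X_{1..N}) : bool :=
  [forall S : {set 'I_N}, (#|S| == d.+1) ==> ~~ (mlead (f S) <= m)%MM].

Lemma standard_reduction (p : R) : exists r : R,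
  I (p - r) /\ supported (fun m => standard m /\ (mdeg m <= mdeg (mlead p))%N) r.
Proof.
(* The monomial order refines the degree and supports well-founded induction on the leading
   monomial. *)
suff [r [pI rS]] : exists r : R,
    I (p - r) /\ supported (fun m => standard m /\ (m <= mlead p)%O) r.
  by exists r; split=> // m /rS[sm /lemc_mdeg].
elim/mleadrect: p => p IH; have [->|p0] := eqVneq p 0.
  by exists 0; split; [rewrite subr0; apply: gen_ideal0 | apply: supported0].
set m := mlead p; set c := mleadc p.
have [q [r0 [qm qc qI r0S]]] : exists q r0 : R, [/\ (mlead q <= m)%O, q@_m = c,
    I (q - r0) & supported (fun x => standard x /\ (x <= m)%O) r0].
  have [sm|/forallPn[S]] := boolP (standard m).
    exists (c *: 'X_[m]), (c *: 'X_[m]); split.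
    - by apply: le_trans (mleadZ_le _ _) _; rewrite mleadXm.
    - by rewrite mcoeffZ mcoeffX eqxx mulr1.
    - by rewrite subrr; apply: gen_ideal0.
    by apply: supportedZ; apply: supportedX; rewrite sm lexx.
  rewrite negb_imply negbK => /andP[/eqP/fI[fSI _ fS0] le_m].
  have mE : m = (mlead (f S) + (m - mlead (f S)))%MM by rewrite addmC submK.
  exists ((c / mleadc (f S)) *: (f S * 'X_[m - mlead (f S)])), 0; split.
  - apply: le_trans (mleadZ_le _ _) _; apply: le_trans (mleadM_le _ _) _.
    by rewrite mleadXm -mE.
  - have coefE : (f S * 'X_[m - mlead (f S)])@_m = mleadc (f S).
      by rewrite [X in _@_X = _]mE addmC mcoeffMX.
    by rewrite mcoeffZ coefE divfK // mleadc_eq0.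
  - rewrite subr0 -mul_mpolyC mulrCA mulrC; exact: gen_idealM.
  exact: supported0.
have [r1 [r1I r1S]] : exists r1 : R, I (p - q - r1) /\
    supported (fun x => standard x /\ (x <= m)%O) r1.
  have [->|pq0] := eqVneq (p - q) 0.
    by exists 0; split; [rewrite subr0; apply: gen_ideal0 | apply: supported0].
  have lt_pq : (mlead (p - q) < m)%O.
    rewrite lt_neqAle (le_trans (mleadB_le _ _)) ?leUx ?lexx ?qm // andbT.
    apply: contraNneq pq0 => pqm; rewrite -mleadc_eq0 pqm mcoeffB qc.
    by rewrite subrr.
  have [r1 [r1I r1S]] := IH _ lt_pq; exists r1; split=> // x /r1S[sx le_x].
  by split=> //; apply: le_trans le_x (ltW lt_pq).
exists (r0 + r1); split; last exact: supportedD.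
have -> : p - (r0 + r1) = (p - q - r1) + (q - r0).
  by rewrite [p - q - r1]addrAC subrKA -addrA -opprD [r1 + r0]addrC.
exact: gen_idealD.
Qed.

(** Larger than every exponent of every [mlead (f S)], so that [d.+1] exponents [>= E] force
    divisibility by one of these. *)
Let E := (\sum_(S : {set 'I_N}) mdeg (mlead (f S))).+1.

(* A standard monomial has at most [d] exponents that are [>= E]. *)
Lemma card_standard M :
  (#|[pred e : {ffun 'I_N -> 'I_M.+1} | standard (box_mnm e)]|
     <= 2 ^ N * E ^ N * M.+1 ^ d)%N.
Proof.
pose big_set (e : {ffun 'I_N -> 'I_M.+1}) := [set i | (E <= e i)%N].
have card_big e : standard (box_mnm e) -> (#|big_set e| <= d)%N.
  move=> se; rewrite leqNgt; apply/negP => lt_d.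
  have [S SB /eqP cS] : exists2 S : {set 'I_N}, S \subset big_set e & #|S| == d.+1.
    exists [set x in take d.+1 (enum (big_set e))].
      by apply/subsetP=> x; rewrite inE => /mem_take; rewrite mem_enum.
    rewrite cardsE; apply/eqP; rewrite (card_uniqP _) ?take_uniq ?enum_uniq //.
    by rewrite size_takel // -cardE.
  have [_ fS _] := fI cS; have /forallP/(_ S) := se; rewrite cS eqxx /=.
  apply/negP; rewrite negbK; apply/mnm_lepP=> i.
  have [iS|iS] := boolP (i \in S); last first.
    have [fS0|fS0] := eqVneq (f S) 0; first by rewrite fS0 mlead0 mnm0E.
    by rewrite (fS _ (mlead_supp fS0)).
  have := subsetP SB i iS; rewrite inE mnmE; apply: leq_trans.
  apply: leq_trans (leq_mnm_mdeg _ i) _; rewrite leqW //.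
  by rewrite (bigD1 S) //= leq_addr.
(* A standard monomial is recovered from the positions of its exponents [>= E], all exponents
   truncated to [E.-1], and the list of the at most [d] large ones. *)
pose code (e : {ffun 'I_N -> 'I_M.+1}) :
    {set 'I_N} * {ffun 'I_N -> 'I_E} * {ffun 'I_d -> 'I_M.+1} :=
  (big_set e, [ffun i => inord (minn (e i) E.-1)],
   [ffun k => nth ord0 [seq e i | i <- enum (big_set e)] (k : 'I_d)]).
have <- : #|{: {set 'I_N} * {ffun 'I_N -> 'I_E} * {ffun 'I_d -> 'I_M.+1}}|
    = (2 ^ N * E ^ N * M.+1 ^ d)%N.
  by rewrite !card_prod !card_ffun !card_ord -cardsT -powersetT card_powerset
             cardsT card_ord.
rewrite -(card_in_imset (f := code)); first exact: max_card.
move=> e e' se se'; rewrite /code => -[eqB eqs eql].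
apply/ffunP => i; have [iB|iB] := boolP (i \in big_set e).
  have ile : (index i (enum (big_set e)) < size (enum (big_set e)))%N.
    by rewrite index_mem mem_enum.
  have id : (index i (enum (big_set e)) < d)%N.
    by apply: leq_trans ile _; rewrite -cardE card_big.
  have := congr1 (fun h : {ffun _ -> _} => h (Ordinal id)) eql.
  rewrite !ffunE -eqB !(nth_map i) //= nth_index ?mem_enum //.
have := congr1 (fun h : {ffun _ -> _} => val (h i)) eqs.
rewrite /= !ffunE !inordK ?ltnS ?geq_minr // => eqi; apply: val_inj.
have lei : (e i <= E.-1)%N by move: iB; rewrite inE -ltnNge.
have lei' : (e' i <= E.-1)%N by move: iB; rewrite eqB inE -ltnNge.
by rewrite -[LHS](minn_idPl lei) eqi (minn_idPl lei').
Qed.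

Definition vanishing k (p : R) := supported (fun m => k <= mdeg m)%N p.

Lemma vanishingM k l p q :
  vanishing k p -> vanishing l q -> vanishing (k + l) (p * q).
Proof. by apply: supportedM => m1 m2 ? ?; rewrite mdegD leq_add. Qed.

Lemma vanishing0 p : vanishing 0 p. Proof. by []. Qed.

Lemma vanishing_g i : vanishing 1 (g i).
Proof.
move=> m; apply: contraTltn; rewrite leqn0 mdeg_eq0 => /eqP->.
by rewrite mcoeff_msupp g0 eqxx.
Qed.

Lemma vanishing_mmap1 (a : 'X_{1..n}) : vanishing (mdeg a) (mmap1 g a).
Proof.
rewrite mdegE /mmap1; elim/big_rec2: _ => [|i k p _ IH]; first exact: vanishing0.
apply: vanishingM => //; elim: (a i) => [|j IHj]; first exact: vanishing0.
by rewrite exprS -add1n; apply: vanishingM => //; apply: vanishing_g.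
Qed.

Section Spanning.
Variable L : nat.
Let M := (N * L)%N.
Let std := {e : {ffun 'I_N -> 'I_M.+1} | standard (box_mnm e)}.
Let J := ({ffun 'I_n -> 'I_M.+1} * std)%type.
Let spanning := \matrix_(j < #|{: J}|)
  coef_box L (mmap1 g (box_mnm (enum_val j).1) * 'X_[box_mnm (val (enum_val j).2)]).

Lemma coef_box_vanishing p : vanishing M.+1 p -> coef_box L p = 0.
Proof.
move=> pM; apply/rowP=> e; rewrite !mxE; apply: memN_msupp_eq0.
by apply/negP => /pM; rewrite ltnNge mdeg_box_mnm.
Qed.

(** Replacing the low part of [p] by its standard remainder leaves terms with one more factor [g i],
    so [mdeg a] grows; once it passes [M = N * L] the product is invisible in the box. The fuel [k]
    bounds the remaining rounds. *)
Lemma coef_box_span k p (a : 'X_{1..n}) : (M < mdeg a + k)%N ->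
  (coef_box L (mmap1 g a * p) <= spanning)%MS.
Proof.
have big_deg q (c : 'X_{1..n}) : (M < mdeg c)%N ->
    (coef_box L (mmap1 g c * q) <= spanning)%MS.
  move=> ltM; rewrite coef_box_vanishing ?sub0mx //.
  move=> m /(vanishingM (@vanishing_mmap1 c) (@vanishing0 q)).
  by rewrite addn0; apply: leq_trans.
elim: k p a => [|k IHk] p a; first by rewrite addn0; apply: big_deg.
move=> lt_Mak; have [le_aM|] := leqP (mdeg a) M; last exact: big_deg.
pose low := \sum_(m <- msupp p | (mdeg m <= M)%N) p@_m *: 'X_[m].
pose high := \sum_(m <- msupp p | ~~ (mdeg m <= M)%N) p@_m *: 'X_[m].
have -> : p = low + high by rewrite [LHS]mpolyE (bigID (fun m => mdeg m <= M)%N).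
rewrite mulrDr linearD /= addmx_sub //; last first.
  rewrite coef_box_vanishing ?sub0mx // => m.
  move=> /(vanishingM (@vanishing0 _) (_ : vanishing M.+1 high)); apply.
  apply: supported_sum => x ltx; apply: supportedZ; apply: supportedX.
  by rewrite ltnNge.
have [r [[h lowE] rS]] := standard_reduction low.
have lowM : (mdeg (mlead low) <= M)%N.
  have [->|low0] := eqVneq low 0; first by rewrite mlead0 mdeg0.
  have : supported (fun m => mdeg m <= M)%N low.
    by apply: supported_sum => x lex; apply: supportedZ; apply: supportedX.
  by apply; apply: mlead_supp.
have -> : low = r + \sum_i h i * g i by rewrite -lowE addrC subrK.
rewrite mulrDr linearD /= addmx_sub //; last first.
  rewrite mulr_sumr linear_sum; apply: summx_sub => i _ /=.
  have -> : mmap1 g a * (h i * g i) = mmap1 g (a + U_(i)) * h i.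
    rewrite commr_mmap1_M => [|x y]; last by rewrite /GRing.comm mulrC.
    by rewrite mmap1U -mulrA [g i * _]mulrC.
  by apply: IHk; rewrite mdegD mdeg1 -addnA add1n.
rewrite [r]mpolyE mulr_sumr linear_sum big_seq; apply: summx_sub => m mr.
have [sm lem] := rS m mr; rewrite -scalerAr linearZ /=; apply: scalemx_sub.
have [e eE] := box_mnmP (leq_trans lem lowM); rewrite -eE in sm *.
have [c cE] := box_mnmP le_aM; rewrite -cE.
pose j : J := (c, exist _ e sm).
by rewrite (_ : coef_box _ _ = row (enum_rank j) spanning) ?row_sub // rowK enum_rankK.
Qed.

Lemma box_leq_span :
  (L.+1 ^ N <= M.+1 ^ n * (2 ^ N * E ^ N * M.+1 ^ d))%N.
Proof.
have full : (1%:M <= spanning)%MS.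
  apply/row_subP=> e; rewrite -[e]enum_valK; set x := enum_val e.
  have -> : row (enum_rank x) 1%:M = coef_box L (mmap1 g 0%MM * 'X_[box_mnm x]).
    apply/rowP=> y; rewrite !mxE mmap11 mul1r mcoeffX (inj_eq (@box_mnm_inj N L)).
    by rewrite -(inj_eq enum_val_inj) enum_rankK.
  by apply: (@coef_box_span M.+1); rewrite mdeg0.
rewrite -(@card_box N L) -(mxrank1 K #|{ffun 'I_N -> 'I_L.+1}|).
apply: leq_trans (mxrankS full) _.
apply: leq_trans (rank_leq_row _) _; rewrite card_prod card_box.
by rewrite leq_mul2l card_sig card_standard orbT.
Qed.

End Spanning.

Lemma standard_dim : (N <= n + d)%N.
Proof.
rewrite leqNgt; apply/negP => lt_N.
have N0 : (0 < N)%N by apply: leq_ltn_trans lt_N.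
(* The upper bound is at most [L * L.+1 ^ (n + d)], whereas [L.+1 ^ N] has at least one more factor
   [L.+1]. *)
pose L := (N ^ N * (2 ^ N * E ^ N))%N.
have /negP[] : ~~ (L.+1 ^ N <= (N * L).+1 ^ n * (2 ^ N * E ^ N * (N * L).+1 ^ d))%N.
  rewrite -ltnNge mulnCA -expnD mulnC.
  have le1 : ((N * L).+1 <= N * L.+1)%N by rewrite mulnS -add1n leq_add2r.
  apply: (@leq_ltn_trans ((N * L.+1) ^ (n + d) * (2 ^ N * E ^ N))).
    rewrite leq_mul2r; apply/orP; right.
    have [->|nd0] := posnP (n + d)%N; first by rewrite !expn0.
    by rewrite leq_exp2r.
  have NE : N = (N - (n + d) + (n + d))%N by rewrite subnK // ltnW.
  rewrite expnMn [X in (_ < _ ^ X)%N]NE [in ltnRHS]expnD mulnAC.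
  rewrite ltn_pmul2r ?expn_gt0 //.
  apply: (@leq_ltn_trans L); first by rewrite leq_mul2r leq_pexp2l ?(ltnW lt_N) ?orbT.
  apply: (@leq_trans (L.+1 ^ 1)); first by rewrite expn1.
  by rewrite leq_pexp2l // subn_gt0.
exact: box_leq_span.
Qed.
End Reduction.

Lemma exists_alg_free : exists2 S : {set 'I_N}, alg_free S I & (N <= #|S| + n)%N.
Proof.
apply: boolp.contrapT => no.
have [le_Nn|lt_nN] := leqP N n.
  by apply: no; exists set0; [apply: alg_free0 | rewrite cards0].
(* Sets of [d.+1 = N - n] variables are just large enough, so each is dependent by assumption;
   [standard_dim] refutes this. *)
pose d := (N - n).-1.
have : forall S : {set 'I_N}, exists f : R,
    #|S| = d.+1 -> [/\ I f, in_vars S f & f != 0].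
  move=> S; apply: boolp.contrapT => noS; apply: no; exists S.
    move=> f If fS; apply: boolp.contrapT => f0; apply: noS.
    by exists f => _; split=> //; apply/eqP.
  rewrite leqNgt; apply/negP => ltS; apply: noS; exists 0 => cS.
  by move: ltS; rewrite cS prednK ?subn_gt0 // subnK ?ltnn // ltnW.
move=> /boolp.choice[f fI].
have := standard_dim fI; rewrite leqNgt => /negP[].
rewrite -[ltnRHS](subnKC (ltnW lt_nN)) ltn_add2l ltn_predL ?subn_gt0 //.
Qed.

End StandardMonomials.

(** * Primes that contain no nonzero polynomial in given variables *)

Section PrimeAvoidance.
Variables (N : nat) (K : fieldType).
Local Notation R := {mpoly K[N]}.

Definition is_ideal (A : R -> Prop) : Prop :=
  [/\ A 0, forall x y, A x -> A y -> A (x + y) & forall a x, A x -> A (a * x)].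

Lemma maximal_alg_free (A : R -> Prop) (S : {set 'I_N}) :
  is_ideal A -> alg_free S A ->
  exists B, [/\ is_ideal B, alg_free S B, forall x, A x -> B x
    & forall C, is_ideal C -> alg_free S C -> (forall x, B x -> C x) ->
      forall x, C x -> B x].
Proof.
move=> idA freeA.
pose good (B : R -> Prop) :=
  [/\ is_ideal B, alg_free S B & forall x, A x -> B x].
pose T := {B : R -> Prop | good B}.
have goodA : good A by [].
have [|||[B goodB] maxB] := @classical_sets.ZL_preorder T (exist _ A goodA)
  (fun B C => boolp.asbool (forall x, sval B x -> sval C x)).
- by move=> B; apply/boolp.asboolP.
- by move=> r s t /boolp.asboolP rs /boolp.asboolP st; apply/boolp.asboolP => x /rs /st.
- move=> F totF; have [[B0 FB0]|noF] := boolp.pselect (exists B, F B); last first.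
    by exists (exist _ A goodA) => B FB; case: noF; exists B.
  pose U x := exists2 B : T, F B & sval B x.
  have goodU : good U.
    split; first split.
    - by exists B0 => //; case: (svalP B0) => -[].
    - move=> x y [B FB Bx] [C FC Cy]; case: (totF B C FB FC) => /boolp.asboolP sub.
        by exists C => //; case: (svalP C) => -[_ CD _] _ _; apply: CD => //; apply: sub.
      by exists B => //; case: (svalP B) => -[_ BD _] _ _; apply: BD => //; apply: sub.
    - by move=> a x [B FB Bx]; exists B => //; case: (svalP B) => -[_ _ BM] _ _; apply: BM.
    - by move=> f [B FB Bf]; case: (svalP B) => _ freeB _; apply: freeB.
    by move=> x Ax; exists B0 => //; case: (svalP B0) => _ _; apply.
  by exists (exist _ U goodU) => B FB; apply/boolp.asboolP => x Bx; exists B.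
case: (goodB) => idB freeB AB; exists B; split=> // C idC freeC BC x Cx.
have goodC : good C by split=> // y /AB /BC.
by have /boolp.asboolP := maxB (exist _ C goodC) (introT (boolp.asboolP _) BC); apply.
Qed.

(** The nonzero polynomials in the variables [S] form a multiplicative set, and an ideal maximal
    among those avoiding it is prime. *)
Lemma exists_prime_alg_free (A : R -> Prop) (S : {set 'I_N}) :
  is_ideal A -> alg_free S A ->
  exists2 P : prime_idealr R, prime_over A P & alg_free S (fun f => f \in P).
Proof.
move=> idA freeA.
have [B [[B0 BD BM] freeB AB maxB]] := maximal_alg_free idA freeA.
pose P : {pred R} := fun x => boolp.asbool (B x).
have PE x : reflect (B x) (x \in P) by apply: boolp.asboolP.
have B1 : ~ B 1.
  by move=> /freeB /(_ (@in_vars1 N K S)) /eqP; rewrite oner_eq0.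
(* By maximality [B + (u)] meets the polynomials in the variables [S]. *)
have adjoin u : ~ B u -> exists b a : R,
    [/\ B b, in_vars S (b + a * u) & b + a * u != 0].
  move=> Bu; apply: boolp.contrapT => no; apply: Bu.
  apply: (maxB (fun x => exists b a : R, B b /\ x = b + a * u)).
  - split=> [|x y [b [a [Bb ->]]] [b' [a' [Bb' ->]]]|c x [b [a [Bb ->]]]].
    + by exists 0, 0; rewrite mul0r addr0.
    + exists (b + b'), (a + a'); split; first exact: BD.
      by rewrite mulrDl addrACA.
    by exists (c * b), (c * a); rewrite mulrDr mulrA; split=> //; apply: BM.
  - move=> x [b [a [Bb ->]]] xS; apply: boolp.contrapT => x0; apply: no.
    by exists b, a; split=> //; apply/eqP.
  - by move=> x Bx; exists x, 0; rewrite mul0r addr0.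
  by exists 0, 1; rewrite mul1r add0r.
have idealP : idealr_closed P.
  split; first exact/PE; first exact/PE.
  by move=> a u v /PE Bu /PE Bv; apply/PE; apply: BD => //; apply: BM.
have primeP : prime_idealr_closed P.
  move=> u v /PE Buv; apply: contraT; rewrite negb_or => /andP[/PE Bu /PE Bv].
  have [b [a [Bb s1 n1]]] := adjoin u Bu; have [b' [a' [Bb' s2 n2]]] := adjoin v Bv.
  suff /freeB : B ((b + a * u) * (b' + a' * v)).
    by move=> /(_ (in_varsM s1 s2)) /eqP; rewrite mulf_eq0 (negPf n1) (negPf n2).
  rewrite mulrDr; apply: (BD); first exact: BM.
  rewrite mulrDl; apply: (BD); first by rewrite mulrC; apply: BM.
  by rewrite mulrACA; apply: BM.
pose I1 := isIdealr.Build R P idealP.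
pose I2 := isPrimeIdealrClosed.Build R P primeP.
pose PP : prime_idealr R := HB.pack P I1 I2.
exists PP; first by move=> x /AB Bx; apply/PE.
by move=> f /PE Bf; apply: freeB.
Qed.

End PrimeAvoidance.

(* Krull's height theorem for some prime through the origin. *)
Lemma exists_prime_height_leq (N : nat) (K : fieldType) (n : nat)
    (g : 'I_n -> {mpoly K[N]}) :
  (forall i, (g i)@_0%MM = 0) ->
  exists2 P : prime_idealr {mpoly K[N]},
    prime_over (gen_ideal xpredT g) P & ~ height_ge P n.+1.
Proof.
move=> g0; have [S freeS NS] := exists_alg_free g0.
have idI : is_ideal (gen_ideal xpredT g).
  by split; [apply: gen_ideal0 | apply: gen_idealD | apply: gen_idealM].
have [P IP freeP] := exists_prime_alg_free idI freeS; exists P => //.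
move=> /(height_leq_free freeP); rewrite addnS => /leq_trans /(_ NS).
by rewrite ltnn.
Qed.

(** * Generators of the border basis ideal *)

Lemma telescope_commutator (R : pzRingType) (x y : R) l :
  \sum_(i < l.+1) y ^+ i * (x * y - y * x) * y ^+ (l - i)
    = x * y ^+ l.+1 - y ^+ l.+1 * x.
Proof.
pose F i := - (y ^+ i * x * y ^+ (l.+1 - i)).
have -> : x * y ^+ l.+1 - y ^+ l.+1 * x = F l.+1 - F 0%N.
  by rewrite /F subnn subn0 expr0 mul1r mulr1 opprK addrC.
rewrite -telescope_sumr // big_mkord; apply: eq_bigr => i _.
have le_il : (i <= l)%N by rewrite -ltnS.
rewrite /F opprK [RHS]addrC subSS subSn // (exprSr y i) (exprS y (l - i)).
by rewrite mulrBr mulrBl !mulrA.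
Qed.

(* [\sum_i y^(l-i) x^k y^i] is, up to cyclic permutation, the noncommutative
   derivative of [x^k y^(l+1)] with respect to [y]. *)
Definition cyclic_word (R : pzRingType) (x y : R) k l : R :=
  \sum_(i < l.+1) y ^+ (l - i) * (x ^+ k * y ^+ i).

(** Cyclicity of the trace moves [Y ^+ (l - i)] to the right, the sum telescopes to [[X, Y^(l+1)]],
    and [X^k [X, Y^(l+1)]] has trace 0 by cyclicity again. *)
Lemma mxtrace_cyclic_word (R : comPzRingType) n (X Y : 'M[R]_n) k l :
  \tr (cyclic_word X Y k l * (X * Y - Y * X)) = 0.
Proof.
have -> : \tr (cyclic_word X Y k l * (X * Y - Y * X)) =
    \tr (X ^+ k * \sum_(i < l.+1) Y ^+ i * (X * Y - Y * X) * Y ^+ (l - i)).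
  rewrite mulr_suml mulr_sumr !raddf_sum; apply: eq_bigr => i _ /=.
  rewrite -[LHS]/(\tr (Y ^+ (l - i) *m _ *m _)) -mulmxA mxtrace_mulC.
  by rewrite -!mulmxE !mulmxA.
rewrite telescope_commutator mulrBr raddfB /= mulrA -exprSr mulrA.
have -> : \tr (X ^+ k * Y ^+ l.+1 * X) = \tr (X * (X ^+ k * Y ^+ l.+1)).
  exact: mxtrace_mulC.
by rewrite mulrA -exprS subrr.
Qed.

Lemma commutator_col0 (R : pzRingType) n (B C : 'M[R]_n) (v vB vC w : 'cV_n) :
  B *m v = vB -> C *m v = vC -> B *m vC = w -> C *m vB = w ->
  (B *m C - C *m B) *m v = 0.
Proof.
by move=> Bv Cv Bw Cw; rewrite mulmxBl -!mulmxA Bv Cv Bw Cw subrr.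
Qed.

Lemma ord2P (k : 'I_2) : k = x1 \/ k = x2.
Proof. by case: k => -[|[|//]] ?; [left | right]; apply: val_inj. Qed.

Section BorderBasis.
Variables (K : fieldType) (mu nu : nat).
Variables (t : mu.-tuple 'X_{1..2}) (b : nu.-tuple 'X_{1..2}).
Hypotheses (tO : order_ideal t) (bO : is_border t b).
Local Notation Kc := {mpoly K[mu * nu]}.
Local Notation A := (mult_mx K t b).

Lemma uniq_t : uniq t. Proof. by case: tO. Qed.
Lemma uniq_b : uniq b. Proof. by case: bO. Qed.

Lemma dvd_t m m' : m' \in t -> (m <= m')%MM -> m \in t.
Proof. by case: tO => _; apply. Qed.

Lemma tnth_t_inj : injective (tnth t).
Proof. by apply/tuple_uniqP/uniq_t. Qed.

Lemma mulU_t k m : (U_(k) + m)%MM \in t -> m \in t.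
Proof. by move=> /dvd_t; apply; apply: lem_addl. Qed.

(* The coordinates on [t] of the normal form of [m], for [m] in [t] or in the
   border. *)
Definition nf_col (m : 'X_{1..2}) : 'cV[Kc]_mu :=
  \col_r if m == tnth t r then 1
    else if m \in t then 0
    else if [pick j | tnth b j == m] is Some j then indet K r j
    else 0.

(** For [m] outside [t] this is 0, as in the quotient by the span of the monomials outside [t]. *)
Definition mono_col (R : nzRingType) (m : 'X_{1..2}) : 'cV[R]_mu :=
  \col_r (m == tnth t r)%:R.

Lemma nf_col_in m : m \in t -> nf_col m = mono_col Kc m.
Proof. by move=> mt; apply/colP=> r; rewrite !mxE mt; case: eqP. Qed.

Lemma nf_col_border j : nf_col (tnth b j) = \col_r indet K r j.
Proof.
have bt : tnth b j \notin t.
  by have := mem_tnth j b; rewrite bO.2 mem_filter => /andP[].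
apply/colP=> r; rewrite !mxE (negPf bt).
case: eqP => [bE|_]; first by rewrite bE mem_tnth in bt.
case: pickP => [j' /eqP bb'|/(_ j)]; last by rewrite eqxx.
by congr indet; apply: (tuple_uniqP _ uniq_b).
Qed.

Lemma mul_mono_col (R : nzRingType) n (B : 'M[R]_(n, mu)) s :
  B *m mono_col R (tnth t s) = col s B.
Proof.
rewrite colE; congr (_ *m _); apply/colP=> r.
by rewrite !mxE (inj_eq tnth_t_inj) eq_sym andbT.
Qed.

Lemma mult_mx_col k m : m \in t -> A k *m mono_col Kc m = nf_col (U_(k) + m).
Proof. by case/tnthP=> s ->; rewrite mul_mono_col; apply/colP=> r; rewrite !mxE. Qed.

Lemma mult_mx_exp_col k j m : (U_(k) *+ j + m)%MM \in t ->
  A k ^+ j *m mono_col Kc m = mono_col Kc (U_(k) *+ j + m).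
Proof.
elim: j => [|j IHj]; first by rewrite expr0 mul1mx mulm0n add0m.
rewrite mulmS -addmA => kt; have jt := mulU_t kt.
by rewrite exprS -mulmxE -mulmxA IHj // mult_mx_col // nf_col_in.
Qed.

(** Both paths from [t_q] stay in [t] for one step and end at the normal form of [x1 x2 t_q], even
    when this is a border monomial. *)
Lemma rho_trivially_zero pq : trivially_zero t pq -> rho K t b pq = 0.
Proof.
case: pq => p q /andP[/= t1 t2].
have /colP/(_ p) : col q (A x1 *m A x2 - A x2 *m A x1) = 0.
  rewrite -mul_mono_col; apply: (@commutator_col0 _ _ _ _ _ _ _
    (nf_col (U_(x1) + (U_(x2) + tnth t q)))).
  - exact: mult_mx_col (mem_tnth q t).
  - exact: mult_mx_col (mem_tnth q t).
  - by rewrite nf_col_in // mult_mx_col.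
  by rewrite nf_col_in // mult_mx_col // !addmA [(U_(x2) + U_(x1))%MM]addmC.
by rewrite [LHS]mxE [RHS]mxE.
Qed.

(** At the origin border monomials become 0, so the matrices are the multiplications of a monomial
    quotient algebra and commute. *)
Lemma rho_coef0 pq : (rho K t b pq)@_0%MM = 0.
Proof.
case: pq => p q; pose e := mcoeff 0%MM : {rmorphism Kc -> K}.
pose A0 k := map_mx e (A k).
have A0E k m : A0 k *m mono_col K m = mono_col K (U_(k) + m).
  have [/tnthP[s ->]|mt] := boolP (m \in t).
    rewrite mul_mono_col; apply/colP=> r; rewrite !mxE /=.
    case: eqP => _; first by rewrite mcoeff1 eqxx.
    case: ifP => _; first exact: mcoeff0.
    case: pickP => [j _|_]; last exact: mcoeff0.
    by rewrite /indet mcoeffX mnm1_eq0.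
  have -> : mono_col K m = 0.
    by apply/colP=> r; rewrite !mxE; case: eqP mt => // ->; rewrite mem_tnth.
  rewrite mulmx0; apply/colP=> r; rewrite !mxE; case: eqP => // kmE.
  by case/negP: mt; apply: (@mulU_t k); rewrite kmE mem_tnth.
have /colP/(_ p) : col q (A0 x1 *m A0 x2 - A0 x2 *m A0 x1) = 0.
  rewrite -mul_mono_col; apply: (@commutator_col0 _ _ _ _ _ _ _
    (mono_col K (U_(x1) + (U_(x2) + tnth t q))) (A0E x1 _) (A0E x2 _) (A0E x1 _)).
  by rewrite A0E !addmA [(U_(x2) + U_(x1))%MM]addmC.
by rewrite -!map_mxM -map_mxB [LHS]mxE [LHS]mxE [RHS]mxE.
Qed.

Lemma mnm2P (m m' : 'X_{1..2}) : m x1 = m' x1 -> m x2 = m' x2 -> m = m'.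
Proof. by move=> e1 e2; apply/mnmP=> i; have [->|->] := ord2P i. Qed.

Lemma mnm2_lep (m m' : 'X_{1..2}) :
  (m x1 <= m' x1)%N -> (m x2 <= m' x2)%N -> (m <= m')%MM.
Proof.
by move=> e1 e2; apply/mnm_lepP => i; have [->|->] := ord2P i.
Qed.

Definition mnm2 i j : 'X_{1..2} := (U_(x1) *+ i + U_(x2) *+ j)%MM.

Lemma mnm2_x1 i j : mnm2 i j x1 = i.
Proof. by rewrite mnmDE !mulmnE !mnm1E /= mul0n mul1n addn0. Qed.

Lemma mnm2_x2 i j : mnm2 i j x2 = j.
Proof. by rewrite mnmDE !mulmnE !mnm1E /= mul0n mul1n. Qed.

(** Every monomial met on the way divides [mnm2 k (l + u)], so it stays in [t], and each of the
    [l.+1] summands contributes the same column. *)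
Lemma cyclic_word_col k l u : mnm2 k (l + u) \in t ->
  cyclic_word (A x1) (A x2) k l *m mono_col Kc (U_(x2) *+ u)
    = l.+1%:R *: mono_col Kc (mnm2 k (l + u)).
Proof.
move=> klt; rewrite mulmx_suml (eq_bigr (fun=> mono_col Kc (mnm2 k (l + u)))).
  by rewrite sumr_const card_ord scaler_nat.
move=> i _; have le_il : (i <= l)%N by rewrite -ltnS.
have sub_t (m : 'X_{1..2}) : (m x1 <= k)%N -> (m x2 <= l + u)%N -> m \in t.
  by move=> h1 h2; apply: dvd_t klt _; apply: mnm2_lep; rewrite ?mnm2_x1 ?mnm2_x2.
have E : (U_(x2) *+ (l - i) + (U_(x1) *+ k + (U_(x2) *+ i + U_(x2) *+ u)))%MM
    = mnm2 k (l + u).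
  apply: mnm2P; rewrite ?mnm2_x1 ?mnm2_x2 !mnmDE !mulmnE !mnm1E /=.
    by rewrite !(mul0n, mul1n, addn0).
  by rewrite !(mul0n, mul1n, add0n) addnA subnK.
rewrite -!mulmxE -!mulmxA mult_mx_exp_col; last first.
  by apply: sub_t; rewrite mnmDE !mulmnE !mnm1E /= !(mul0n, mul1n) ?leq_add2r.
rewrite mult_mx_exp_col; last first.
  by apply: sub_t; rewrite !mnmDE !mulmnE !mnm1E /= !(mul0n, mul1n, addn0, add0n)
    ?leq_add2r.
by rewrite mult_mx_exp_col E.
Qed.

Lemma extremeP p q :
  reflect [/\ tnth t p = (U_(x2) *+ tnth t p x2)%MM,
      (U_(x2) + tnth t q)%MM \notin t & (tnth t p x2 <= tnth t q x2)%N]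
    (extreme t (p, q)).
Proof.
have E1 : (U_(x1) + U_(x2) + tnth t q)%MM x1 = (tnth t q x1).+1.
  by rewrite !mnmDE !mnm1E.
have E2 : (U_(x1) + U_(x2) + tnth t q)%MM x2 = (tnth t q x2).+1.
  by rewrite !mnmDE !mnm1E.
rewrite /extreme E1 E2 /= !ltnS.
apply: (iffP and4P) => [[/eqP ? ? _ ?]|[e x2tq le_pq]]; first by [].
split=> //; first exact/eqP.
by rewrite e mulmnE mnm1E /= mul0n.
Qed.

Hypothesis charK0 : [pchar K] =i pred0.

Lemma rho_extreme_in_kept pq : extreme t pq ->
  gen_ideal (kept t) (rho K t b) (rho K t b pq).
Proof.
set Jk := gen_ideal _ _.
have Jk0 : Jk 0 by exact: gen_ideal0.
have JkD x y : Jk x -> Jk y -> Jk (x + y) by exact: gen_idealD.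
have JkM c x : Jk x -> Jk (c * x) by exact: gen_idealM.
have Jk_kept pq' : kept t pq' -> Jk (rho K t b pq') by exact: gen_ideal_mem.
(* No [x2]-exponent reaches [bound], so induction on [n] descends through the exponent of [t_p]. *)
pose bound := (\sum_(s < mu) tnth t s x2).+1.
have lt_bound s : (tnth t s x2 < bound)%N by rewrite ltnS (bigD1 s) //= leq_addr.
suff main n p q : extreme t (p, q) -> (bound <= n + tnth t p x2)%N ->
    Jk (rho K t b (p, q)).
  by case: pq => p q /(main bound p q); apply; apply: leq_addr.
elim: n p q => [|n IHn] p q; first by move=> _; rewrite leqNgt lt_bound.
move=> epq le_n; have /extremeP[tp x2tq le_pq] := epq.
set u := tnth t p x2 in tp le_pq le_n.
pose l := (tnth t q x2 - u)%N; pose W := cyclic_word (A x1) (A x2) (tnth t q x1) l.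
have := mxtrace_cyclic_word (A x1) (A x2) (tnth t q x1) l.
rewrite -/W -!mulmxE /mxtrace.
under eq_bigr => i _ do rewrite mxE.
rewrite pair_bigA /= (bigD1 (q, p)) //=.
have Wcol p' u' q' : tnth t p' = (U_(x2) *+ u')%MM -> (u' <= u)%N ->
    W q' p' = l.+1%:R * (mnm2 (tnth t q x1) (l + u') == tnth t q')%:R.
  move=> tp' le_u; have -> : W q' p' = col p' W q' 0 by rewrite mxE.
  rewrite -mul_mono_col tp' cyclic_word_col ?mxE //.
  apply: dvd_t (mem_tnth q t) _; apply: mnm2_lep; rewrite ?mnm2_x1 ?mnm2_x2 //.
  by rewrite -[leqRHS](subnK le_pq) leq_add2l.
have tqE : mnm2 (tnth t q x1) (l + u) = tnth t q.
  by apply: mnm2P; rewrite ?mnm2_x1 ?mnm2_x2 // subnK.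
rewrite (Wcol p u) // tqE eqxx mulr1 => /eqP; rewrite addr_eq0 => /eqP Eq.
suff : Jk (l.+1%:R * rho K t b (p, q)).
  move=> /(JkM (l.+1%:R^-1)%:MP); rewrite -mpolyC_nat mulrA -mpolyCM mulVf.
    by rewrite mpolyC1 mul1r.
  by rewrite ((pcharf0P K).1 charK0).
rewrite -[_ * _]/(_ * (A x1 *m A x2 - A x2 *m A x1) p q) {}Eq -mulN1r.
apply: (JkM); elim/big_ind: _ => // -[q' p'] /= ne.
rewrite -[X in _ * X]/(rho K t b (p', q')).
have [k|] := boolP (kept t (p', q')); first exact/JkM/Jk_kept.
rewrite negb_and !negbK => /orP[/rho_trivially_zero->|e']; first by rewrite mulr0.
have /extremeP[tp' x2tq' le_pq'] := e'; set u' := tnth t p' x2 in tp' le_pq'.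
(* Larger exponents fall to the induction. Otherwise a nonzero coefficient puts [t_q'] in the column
   of [t_q], lower by [u - u']: for [u' = u] this is the excluded pair, for [u' < u] it forces
   [x2 t_q'] into [t]. *)
have [lt_u|le_u] := ltnP u u'.
  apply/JkM/IHn => //; apply: leq_trans le_n _.
  by rewrite addSnnS leq_add2l.
rewrite (Wcol p' u') //; case: eqP => [tq'|_]; last by rewrite mulr0 mul0r.
move: le_u; rewrite leq_eqVlt => /orP[/eqP uu|lt_u].
  case/negP: ne; rewrite xpair_eqE; apply/andP; split; apply/eqP.
    by apply: tnth_t_inj; rewrite -tq' uu tqE.
  by apply: tnth_t_inj; rewrite tp' uu.
case/negP: x2tq'; rewrite -tq'; apply: dvd_t (mem_tnth q t) _.
apply: mnm2_lep; rewrite mnmDE ?mnm2_x1 ?mnm2_x2 mnm1E //=.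
by rewrite add1n -addnS -[leqRHS](subnK le_pq) leq_add2l.
Qed.

Lemma border_basis_ideal_kept :
  same_ideal (border_basis_ideal K t b) (gen_ideal (kept t) (rho K t b)).
Proof.
move=> x; split; last exact: gen_idealS.
move=> [a ->]; apply: (big_ind (gen_ideal (kept t) (rho K t b))).
- exact: gen_ideal0.
- exact: gen_idealD.
move=> pq _; apply: gen_idealM.
have [k|] := boolP (kept t pq); first exact: gen_ideal_mem.
rewrite negb_and !negbK => /orP[/rho_trivially_zero->|]; first exact: gen_ideal0.
exact: rho_extreme_in_kept.
Qed.

(** * Counting the extreme and the trivially zero index pairs *)

Definition top_of_column (m : 'X_{1..2}) : 'X_{1..2} :=
  mnm2 (m x1) (\max_(s < mu | tnth t s x1 == m x1) tnth t s x2).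

Lemma top_of_column_in m : m \in t -> top_of_column m \in t.
Proof.
case/tnthP=> s ->; rewrite /top_of_column.
have [|s' /eqP s'1 ->] := @eq_bigmax_cond _ [pred s' | tnth t s' x1 == tnth t s x1]
    (fun s' => tnth t s' x2).
  by apply/card_gt0P; exists s; rewrite inE.
by rewrite -s'1 (_ : mnm2 _ _ = tnth t s') ?mem_tnth //; apply: mnm2P;
   rewrite ?mnm2_x1 ?mnm2_x2.
Qed.

Lemma leq_top_of_column m : m \in t -> (m x2 <= top_of_column m x2)%N.
Proof.
by case/tnthP=> s ->; rewrite mnm2_x2 (bigD1 s) //= leq_maxl.
Qed.

Lemma top_of_column_uniq m : m \in t -> (U_(x2) + m)%MM \notin t ->
  m = top_of_column m.
Proof.
move=> mt m2; apply: mnm2P; first by rewrite mnm2_x1.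
apply/eqP; rewrite eqn_leq leq_top_of_column //= leqNgt.
apply: contra m2 => lt_m; apply: dvd_t (top_of_column_in mt) _.
by apply: mnm2_lep; rewrite mnmDE mnm1E /= ?add0n ?add1n // mnm2_x1.
Qed.

(** Combining the [x1]-exponent of [t_q] with the [x2]-exponent of [t_p] is a bijection onto [t]:
    conversely, [m] determines the top [t_q] of its column and the power [t_p] of [x2]. *)
Lemma card_extreme : #|extreme t| = mu.
Proof.
pose f (pq : 'I_mu * 'I_mu) := mnm2 (tnth t pq.2 x1) (tnth t pq.1 x2).
suff /perm_size : perm_eq [seq f pq | pq <- enum (extreme t)] t.
  by rewrite size_map -cardE size_tuple.
apply: uniq_perm uniq_t _; first rewrite map_inj_in_uniq ?enum_uniq //.
  move=> [p q] [p' q']; rewrite !mem_enum => /extremeP[tp x2tq _].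
  move=> /extremeP[tp' x2tq' _] /mnmP ff.
  have f1 : tnth t q x1 = tnth t q' x1 by have := ff x1; rewrite !mnm2_x1.
  have f2 : tnth t p x2 = tnth t p' x2 by have := ff x2; rewrite !mnm2_x2.
  congr (_, _); apply: tnth_t_inj; first by rewrite tp tp' f2.
  rewrite (top_of_column_uniq (mem_tnth q t) x2tq).
  by rewrite (top_of_column_uniq (mem_tnth q' t) x2tq') /top_of_column f1.
move=> m; apply/mapP/idP => [[[p q]]|mt].
  rewrite mem_enum => /extremeP[_ _ le_pq] ->; apply: dvd_t (mem_tnth q t) _.
  by apply: mnm2_lep; rewrite ?mnm2_x1 ?mnm2_x2.
have /tnthP[q qE] := top_of_column_in mt.
have /tnthP[p pE] : mnm2 0 (m x2) \in t.
  by apply: dvd_t mt _; apply: mnm2_lep; rewrite ?mnm2_x1 ?mnm2_x2.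
have p2 : tnth t p x2 = m x2 by rewrite -pE mnm2_x2.
have q1 : tnth t q x1 = m x1 by rewrite -qE mnm2_x1.
exists (p, q); last by apply: mnm2P; rewrite ?mnm2_x1 ?mnm2_x2.
rewrite mem_enum; apply/extremeP; split.
- by rewrite p2 -pE; apply: mnm2P; rewrite ?mnm2_x1 ?mnm2_x2 !mulmnE !mnm1E /=
     ?mul1n.
- apply/negP => x2q; have := leq_top_of_column x2q.
  rewrite /top_of_column mnm2_x2 !mnmDE !mnm1E /= q1 add0n add1n.
  by rewrite -qE mnm2_x2 ltnn.
by rewrite p2 -qE leq_top_of_column.
Qed.

Definition two_steps_inside (m : 'X_{1..2}) : bool :=
  ((U_(x1) + m)%MM \in t) && ((U_(x2) + m)%MM \in t).

(* Inclusion-exclusion for [x1 t] and [x2 t], whose union is the border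
   together with [t] minus the monomial 1. *)
Lemma count_two_steps : (0 < mu)%N ->
  (mu + mu = nu + mu.-1 + count two_steps_inside t)%N.
Proof.
move=> mu0; have inj_mul k : injective (fun m : 'X_{1..2} => (U_(k) + m)%MM).
  by move=> m m' /addmI.
pose tx k := [seq (U_(k) + m)%MM | m <- t].
have uniq_tx k : uniq (tx k) by rewrite map_inj_uniq ?uniq_t.
have size_tx k : size (tx k) = mu by rewrite size_map size_tuple.
have mulU_in_tx k m : ((U_(k) + m)%MM \in tx k) = (m \in t).
  by rewrite mem_map.
have in_tx k m : (m \in tx k) -> m != 0%MM.
  by case/mapP=> m' _ ->; rewrite mnmD_eq0 mnm1_eq0.
pose only2 := [seq m <- tx x2 | m \notin tx x1].
have t0 : 0%MM \in t.
  by apply: (@dvd_t _ (tnth t (Ordinal mu0))); rewrite ?mem_tnth //; apply/mnm_lepP=> i;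
     rewrite mnm0E.
have /perm_size : perm_eq (tx x1 ++ only2) (b ++ rem 0%MM t).
  apply: uniq_perm.
  - rewrite cat_uniq uniq_tx filter_uniq ?uniq_tx // andbT.
    by apply/hasPn => m; rewrite mem_filter => /andP[].
  - rewrite cat_uniq uniq_b rem_uniq ?uniq_t // andbT; apply/hasPn => m.
    move=> /mem_rem mt; rewrite bO.2 mem_filter mt //.
  move=> m; rewrite !mem_cat mem_filter bO.2 mem_filter mem_cat.
  rewrite (rem_filter _ uniq_t) mem_filter /= -!/(tx _).
  have [mt|mt] := boolP (m \in t); last by rewrite andbF orbF; case: (m \in tx x1).
  rewrite andbT /=; apply/idP/idP => [|m0].
    by case/orP => [/in_tx//|/andP[_ /in_tx]].
  have [i mi] : exists i, m i != 0%N.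
    apply/existsP; apply: contraR m0; rewrite negb_exists => /forallP m0.
    by apply/eqP/mnmP=> i; have := m0 i; rewrite negbK mnm0E => /eqP.
  have : m \in tx i.
    apply/mapP; exists (m - U_(i))%MM; last by rewrite addmC submK // lep1mP.
    by apply: dvd_t mt _; apply: lem_subr.
  by have [->|->] := ord2P i => ->; rewrite ?andbT ?orbN.
rewrite !size_cat size_rem // !size_tuple.
have sz : (size only2 + count two_steps_inside t = mu)%N.
  (* Multiplication by [x1 x2] maps the counted monomials onto the intersection of [x1 t] and
     [x2 t]: if [x1 m1 = x2 m2], then [m1 = x2 m'] and [m2 = x1 m']. *)
  suff cnt : count two_steps_inside t = count (mem (tx x1)) (tx x2).
    rewrite size_filter cnt addnC.
    exact: etrans (count_predC (mem (tx x1)) (tx x2)) (size_tx x2).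
  rewrite -!size_filter; apply/esym.
  rewrite -[RHS](size_map (fun m => U_(x2) + (U_(x1) + m))%MM).
  apply: perm_size; apply: uniq_perm.
  - by rewrite filter_uniq ?uniq_tx.
  - rewrite map_inj_uniq ?filter_uniq ?uniq_t // => m m' /addmI /addmI //.
  move=> m; rewrite mem_filter; apply/andP/mapP => /=.
    case=> /mapP[m1 m1t mE] /mapP[m2 m2t mE'].
    pose m' := (m1 - U_(x2))%MM.
    have m1E : m1 = (U_(x2) + m')%MM.
      rewrite addmC submK // lep1mP -lt0n.
      have := congr1 (fun m : 'X_{1..2} => m x2) (etrans (esym mE) mE').
      by rewrite !mnmDE !mnm1E /= add0n add1n => ->.
    have m2E : m2 = (U_(x1) + m')%MM.
      apply: (inj_mul x2); rewrite -mE' mE m1E.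
      by rewrite !addmA [(U_(x1) + U_(x2))%MM]addmC.
    exists m'; last by rewrite mE' m2E.
    rewrite mem_filter /two_steps_inside -m1E -m2E m1t m2t.
    by apply: (@mulU_t x2); rewrite -m1E.
  case=> m'; rewrite mem_filter => /andP[/andP[m1 m2] m't] ->.
  split; last by rewrite mulU_in_tx.
  by rewrite addmA [(U_(x2) + U_(x1))%MM]addmC -addmA mulU_in_tx.
move=> sizeE.
by rewrite -sizeE -addnA sz.
Qed.

Lemma card_kept : (#|kept t| + mu * 2 = nu * mu)%N.
Proof.
have [mu0|mu0] := posnP mu.
  have -> : #|kept t| = 0%N.
    by apply: eq_card0 => -[p q]; have := ltn_ord p; rewrite [X in (_ < X)%N]mu0.
  by rewrite [in RHS]mu0 [in LHS]mu0 muln0.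
have card_tz : #|trivially_zero t| = (mu * count two_steps_inside t)%N.
  pose T := [pred q : 'I_mu | two_steps_inside (tnth t q)].
  have -> : count two_steps_inside t = #|T|.
    by rewrite -{1}(map_tnth_enum t) count_map cardE size_filter enumT.
  transitivity (#|'I_mu| * #|T|)%N; last by rewrite card_ord.
  rewrite -cardX; apply: eq_card => -[p q].
  by rewrite !inE.
have disj : [disjoint trivially_zero t & extreme t].
  apply/pred0P => -[p q] /=; apply/negP => /andP[/andP[_ q2] /extremeP[_ /negP]].
  by rewrite /= in q2.
have cardD : #|[predU trivially_zero t & extreme t]|
    = (mu * count two_steps_inside t + mu)%N.
  rewrite -card_tz -[X in (_ + X)%N]card_extreme -cardUI.
  by rewrite (eq_card0 (pred0P disj)) addn0.
have := cardC [predU trivially_zero t & extreme t].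
rewrite cardD card_prod card_ord (_ : #|[predC _]| = #|kept t|); last first.
  by apply: eq_card => pq; rewrite !inE negb_or.
(* Here [c = mu + 1 - nu], whence [mu^2 - mu c - mu = (nu - 2) mu]. *)
have := count_two_steps mu0; move: (count _ _) => c; nia.
Qed.

End BorderBasis.

(** * The Jacobian at a point of the scheme *)

(** The kernel of [E] embeds through [G] into a space of dimension [k]. *)
Lemma row_free_rank_leq (F : fieldType) n m k (E : 'M[F]_(n, m)) (G : 'M[F]_(n, k)) :
  (forall v : 'rV_n, v *m E = 0 -> v *m G = 0 -> v = 0) -> (n <= \rank E + k)%N.
Proof.
move=> EG; have /eqP : row_free (row_mx E G).
  apply: inj_row_free => v; rewrite mul_mx_row -[0]row_mx0.
  by move=> /eq_row_mx[]; apply: EG.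
move=> {1}<-; rewrite -mxrank_tr tr_row_mx -addsmxE.
apply: leq_trans (mxrank_adds_leqif _ _).1 _.
by rewrite !mxrank_tr leq_add2l rank_leq_col.
Qed.

Section Adjoint.
Variables (F : fieldType) (n : nat).
Implicit Types B Y Z : 'M[F]_n.

Definition ad_mx B : 'M[F]_(n * n) := lin_mulmxr B - lin_mulmx B.

Lemma mul_ad_mx B Y : mxvec Y *m ad_mx B = mxvec (Y *m B - B *m Y).
Proof. by rewrite mulmxBr !mul_vec_lin /= linearB. Qed.

Lemma ad_mx_comm B C :
  B *m C = C *m B -> ad_mx B *m ad_mx C = ad_mx C *m ad_mx B.
Proof.
move=> BC; apply/row_matrixP=> k; rewrite !rowE -[delta_mx 0 k]vec_mxK.
rewrite !mulmxA !mul_ad_mx; congr mxvec; set Y := vec_mx _.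
rewrite !(mulmxBl, mulmxBr) !mulmxA -[Y *m B *m C]mulmxA BC mulmxA -BC.
by rewrite !opprB addrACA [RHS]addrACA [in RHS](addrC (- (C *m Y *m B))).
Qed.

Lemma mxvec_dot Y Z : (mxvec Y *m (mxvec Z)^T) 0 0 = \tr (Y *m Z^T).
Proof.
rewrite !mxE (reindex _ (curry_mxvec_bij _ _)) /=.
rewrite /mxtrace; under [RHS]eq_bigr => i _ do rewrite mxE.
rewrite pair_bigA; apply: eq_bigr => -[i j] _ /=.
by rewrite [X in _ * X]mxE !mxvecE mxE.
Qed.

(** The traces of [[Y, B] Z^T] and [Y [B, Z^T]] agree, and the trace form is nondegenerate. *)
Lemma mul_ad_tr_eq0 B Z : ad_mx B *m (mxvec Z)^T = 0 -> B *m Z^T = Z^T *m B.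
Proof.
move=> adZ; apply/eqP; rewrite -subr_eq0; apply/eqP.
have tr0 Y : \tr (Y *m (B *m Z^T - Z^T *m B)) = 0.
  rewrite mulmxBr raddfB /= [Y *m (Z^T *m B)]mulmxA [\tr (_ *m B)]mxtrace_mulC.
  rewrite !mulmxA -raddfB /= -mulmxBl -mxvec_dot -mul_ad_mx -mulmxA adZ.
  by rewrite mulmx0 mxE.
move: (_ - _) tr0 => M tr0; apply/matrixP=> i j; rewrite [RHS]mxE.
have := tr0 (delta_mx j i); rewrite -(mul_delta_mx (0 : 'I_1)) -mulmxA.
by rewrite mxtrace_mulC -rowE -colE /mxtrace big_ord1 !mxE.
Qed.

End Adjoint.

(* [Omega (u, Y) = (u X1 + [Y, B1], u X2 + [Y, B2])] and
   [Phi (Z1, Z2) = [Z1, B2] - [Z2, B1]]; the kernel of [Omega] and, through the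
   trace form, the cokernel of [Phi] inject into the [i0]-th columns. *)
Lemma rank_ad_leq (F : fieldType) N n (X1 X2 : 'M[F]_(N, n * n)) (B1 B2 : 'M[F]_n)
    (i0 : 'I_n) :
  B1 *m B2 = B2 *m B1 ->
  (forall u Y, vec_mx (u *m X1) + (Y *m B1 - B1 *m Y) = 0 ->
     vec_mx (u *m X2) + (Y *m B2 - B2 *m Y) = 0 -> col i0 Y = 0 ->
     Y = 0 /\ u = 0) ->
  (N <= \rank (X1 *m ad_mx B2 - X2 *m ad_mx B1)%R + n * 2)%N.
Proof.
move=> B12 inj.
pose Omega := block_mx X1 X2 (ad_mx B1) (ad_mx B2).
pose Phi := col_mx (ad_mx B2) (- ad_mx B1).
have OP : Omega *m Phi = col_mx (X1 *m ad_mx B2 - X2 *m ad_mx B1) 0.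
  rewrite mul_block_col !mulmxN; congr col_mx.
  by rewrite (ad_mx_comm B12) subrr.
have rO : (N + n * n <= \rank Omega + n * 1)%N.
  apply: (row_free_rank_leq (G := col_mx 0 (lin_mulmxr (delta_mx i0 0)))).
  move=> v; rewrite -[v]hsubmxK -[rsubmx v]vec_mxK.
  set u := lsubmx v; set Y := vec_mx _.
  rewrite mul_row_block -[0 in X in X -> _]row_mx0 => /eq_row_mx[E1 E2].
  rewrite mul_row_col mulmx0 add0r mul_vec_lin => /eqP.
  rewrite mxvec_eq0 /= -colE => /eqP Y0.
  have [||-> ->] := inj u Y _ _ Y0; last by rewrite linear0 row_mx0.
    by apply: (can_inj mxvecK); rewrite linearD /= vec_mxK -mul_ad_mx E1 linear0.
  by apply: (can_inj mxvecK); rewrite linearD /= vec_mxK -mul_ad_mx E2 linear0.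
have rP : (n * n <= \rank Phi + 1 * n)%N.
  rewrite -mxrank_tr.
  apply: (row_free_rank_leq (G := lin_mulmx (delta_mx 0 i0))) => v.
  rewrite -[v]vec_mxK; set Z := vec_mx v; rewrite mul_vec_lin => /eqP.
  rewrite -trmx_eq0 trmx_mul trmxK mul_col_mx col_mx_eq0 mulNmx oppr_eq0.
  move=> /andP[/eqP/mul_ad_tr_eq0 Z2 /eqP/mul_ad_tr_eq0 Z1] /eqP.
  rewrite mxvec_eq0 /= -rowE => /eqP Z0.
  (* The case [u = 0] of [inj]: a matrix that commutes with [B1] and [B2] and has zero column [i0]
     is 0. *)
  suff [Zt0 _] : Z^T = 0 /\ 0 = 0 :> 'rV[F]_N.
    by rewrite -[Z]trmxK Zt0 trmx0 linear0.
  apply: inj; first by rewrite mul0mx linear0 Z1 subrr addr0.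
    by rewrite mul0mx linear0 Z2 subrr addr0.
  by rewrite -tr_row Z0 trmx0.
(* Sylvester's inequality bounds the rank of the product below by [(N + n^2 - n) + (n^2 - n) - 2 n^2
   = N - 2 n]. *)
have := mxrank_mul_min Omega Phi; rewrite OP; set M := X1 *m _ - _.
have -> : \rank (col_mx M (0 : 'M_(n * n, n * n))) = \rank M.
  by rewrite -addsmxE addsmx0.
lia.
Qed.

Lemma eq_row_sub (R : pzRingType) m n (M P Q : 'M[R]_(m, n)) :
  (forall i, row i M = row i P - row i Q) -> M = P - Q.
Proof. by move=> MPQ; apply/row_matrixP=> i; rewrite MPQ linearB. Qed.

Lemma derivation_commutator (R : comNzRingType) (F : fieldType) (phi : R -> F) d n
    (P Q : 'M[R]_n) : derivation_along phi d ->
  map_mx d (P *m Q - Q *m P) =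
    (map_mx d P *m map_mx phi Q - map_mx phi Q *m map_mx d P)
    - (map_mx d Q *m map_mx phi P - map_mx phi P *m map_mx d Q).
Proof.
move=> [dD dM]; have d0 : d 0 = 0 by apply: (addrI (d 0)); rewrite -dD !addr0.
have dB x y : d (x - y) = d x - d y by rewrite -[in RHS](subrK y x) [in RHS]dD addrK.
apply/matrixP=> p q; rewrite !mxE dB !(big_morph d dD d0) -!sumrB.
apply: eq_bigr => i _; rewrite !mxE !dM opprB addrACA -opprD.
rewrite [d (P p i) * _]mulrC [d (Q p i) * _]mulrC.
by rewrite [phi (P p i) * _ + _]addrC.
Qed.

Section Tangent.
Variables (K : fieldType) (mu nu : nat).
Variables (t : mu.-tuple 'X_{1..2}) (b : nu.-tuple 'X_{1..2}).
Hypotheses (tO : order_ideal t) (bO : is_border t b).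
Local Notation Kc := {mpoly K[mu * nu]}.
Local Notation A := (mult_mx K t b).
Variables (F : fieldType) (phi : {rmorphism Kc -> F}).
Hypothesis phi_rho : forall pq, phi (rho K t b pq) = 0.

Let d (k : 'I_(mu * nu)) (x : Kc) : F := phi (mderiv k x).

Lemma d_derivation k : derivation_along phi (d k).
Proof.
split=> x y; rewrite /d; first by rewrite mderivD rmorphD.
by rewrite mderivM rmorphD !rmorphM addrC [phi (mderiv k x) * _]mulrC.
Qed.

Let B k : 'M[F]_mu := map_mx phi (A k).
Let e (m : 'X_{1..2}) : 'cV[F]_mu := mono_col t F m.

Lemma comm_B : B x1 *m B x2 = B x2 *m B x1.
Proof.
apply/eqP; rewrite -subr_eq0 -!map_mxM -map_mxB; apply/eqP/matrixP=> p q.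
by rewrite !mxE -[RHS](phi_rho (p, q)) /rho /=; rewrite !mxE.
Qed.

Lemma B_e k m : m \in t -> (U_(k) + m)%MM \in t -> B k *m e m = e (U_(k) + m).
Proof.
case/tnthP=> s -> kt; rewrite (mul_mono_col tO); apply/colP=> r.
by rewrite !mxE /= kt; case: eqP => _; rewrite ?rmorph1 ?rmorph0.
Qed.

Lemma e_eq0 (Y : 'M[F]_mu) : (forall m, m \in t -> Y *m e m = 0) -> Y = 0.
Proof.
move=> Y0; apply/matrixP=> i j; have /colP/(_ i) := Y0 _ (mem_tnth j t).
by rewrite (mul_mono_col tO) !mxE.
Qed.

(* [1] generates the quotient, so an endomorphism is determined by its value
   on [1] and its commutators with the multiplications inside [t]. *)
Lemma cyclic_eq0 (Y : 'M[F]_mu) (X : 'I_2 -> 'M[F]_mu) :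
  (forall k m, m \in t -> (U_(k) + m)%MM \in t -> X k *m e m = 0) ->
  (forall k, X k + (Y *m B k - B k *m Y) = 0) -> Y *m e 0 = 0 -> Y = 0.
Proof.
move=> X0 XY Ye; apply: e_eq0 => m.
have [k] := ubnP (mdeg m); elim: k m => // k IHk m lt_mk mt.
have [->//|m0] := eqVneq m 0%MM.
have [i mi] : exists i, m i != 0%N.
  apply/existsP; apply: contraR m0; rewrite negb_exists => /forallP m0.
  by apply/eqP/mnmP=> i; have := m0 i; rewrite negbK mnm0E => /eqP.
have mE : m = (U_(i) + (m - U_(i)))%MM by rewrite addmC submK // lep1mP.
have m't : (m - U_(i))%MM \in t by apply: (mulU_t tO (k := i)); rewrite -mE.
rewrite mE -B_e -?mE // mulmxA.
have /eqP := congr1 (mulmx^~ (e (m - U_(i)))) (XY i).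
rewrite mulmxDl X0 -?mE // add0r mulmxBl mul0mx subr_eq0 => /eqP->.
rewrite -mulmxA IHk ?mulmx0 //.
by move: lt_mk; rewrite {1}mE mdegD mdeg1 add1n ltnS.
Qed.

(** The derivative of [A k] at the point [phi] in the direction [u]; [XM k] is its matrix as a
    linear map of [u]. *)
Let X k (u : 'rV[F]_(mu * nu)) : 'M[F]_mu := \sum_j u 0 j *: map_mx (d j) (A k).
Let XM k : 'M[F]_(mu * nu, mu * mu) := \matrix_j mxvec (map_mx (d j) (A k)).

Definition jacobian : 'M[F]_(mu * nu, mu * mu) :=
  \matrix_j mxvec (map_mx (d j) (A x1 *m A x2 - A x2 *m A x1)).

Lemma mul_XM k u : u *m XM k = mxvec (X k u).
Proof.
rewrite mulmx_sum_row linear_sum; apply: eq_bigr => j _.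
by rewrite rowK linearZ.
Qed.

Lemma X_inside k m u : m \in t -> (U_(k) + m)%MM \in t -> X k u *m e m = 0.
Proof.
case/tnthP=> s -> kt; rewrite (mul_mono_col tO); apply/colP=> r.
rewrite !mxE summxE big1 // => j _; rewrite !mxE /= kt /d.
by case: eqP => _; rewrite -?mpolyC1 ?mderivC ?mderiv0 rmorph0 mulr0.
Qed.

(** Each [b_j] is [x1 s] or [x2 s] with [s] in [t], so every indeterminate is an entry of one of the
    two matrices. *)
Lemma X_eq0 u : X x1 u = 0 -> X x2 u = 0 -> u = 0.
Proof.
move=> u1 u2; apply/rowP=> k; rewrite mxE; case/mxvec_indexP: k => i j.
have := mem_tnth j b; rewrite bO.2 mem_filter => /andP[bt].
suff main k : X k u = 0 ->
    tnth b j \in [seq (U_(k) + s)%MM | s <- t] -> u 0 (mxvec_index i j) = 0.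
  by rewrite mem_cat => /orP[]; [apply: main u1 | apply: main u2].
move=> uk /mapP[m /tnthP[s ->] bE].
have /matrixP/(_ i s) := uk; rewrite summxE (bigD1 (mxvec_index i j)) //=.
have AE : A k i s = indet K i j.
  have /colP/(_ i) := nf_col_border K bO j; rewrite [RHS]mxE => <-.
  by rewrite !mxE -bE.
have dA l : (u 0 l *: map_mx (d l) (A k)) i s = u 0 l * (mxvec_index i j == l)%:R.
  rewrite [LHS]mxE [X in _ * X]mxE AE /d /indet mderivX mnm1E.
  have [->|_] := eqVneq; last by rewrite scale0r rmorph0.
  by rewrite scale1r -{1}[U_(_)%MM]add0m addmK mpolyX0 rmorph1.
rewrite dA eqxx mulr1 big1 ?addr0 ?mxE // => l ne.
by rewrite dA eq_sym (negPf ne) mulr0.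
Qed.

Lemma row_XM_ad k (C : 'M[F]_mu) j :
  row j (XM k *m ad_mx C)
    = mxvec (map_mx (d j) (A k) *m C - C *m map_mx (d j) (A k)).
Proof. by rewrite row_mul rowK mul_ad_mx. Qed.

Lemma jacobianE : jacobian = XM x1 *m ad_mx (B x2) - XM x2 *m ad_mx (B x1).
Proof.
apply: eq_row_sub => j; rewrite rowK.
rewrite (derivation_commutator (A x1) (A x2) (d_derivation j)) linearB.
by congr (_ - _); apply/esym/row_XM_ad.
Qed.

(** Column [i0] of [rank_ad_leq] is that of the monomial 1: [cyclic_eq0] gives [Y = 0], and then
    [X_eq0] gives [u = 0]. *)
Lemma rank_jacobian : (mu * nu <= \rank jacobian + mu * 2)%N.
Proof.
have [mu0|mu0] := posnP mu; first by rewrite {1}mu0.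
have /tnthP[i0 t0] : 0%MM \in t.
  apply: (dvd_t tO (m' := tnth t (Ordinal mu0))); first exact: mem_tnth.
  by apply/mnm_lepP=> i; rewrite mnm0E.
have e0 (Y : 'M[F]_mu) : Y *m e 0 = col i0 Y by rewrite t0 (mul_mono_col tO).
rewrite jacobianE; apply: (rank_ad_leq (i0 := i0) comm_B) => u Y E1 E2 Y0.
have E k : X k u + (Y *m B k - B k *m Y) = 0.
  have [->|->] := ord2P k.
    by rewrite -E1; congr (_ + _); rewrite (mul_XM x1) mxvecK.
  by rewrite -E2; congr (_ + _); rewrite (mul_XM x2) mxvecK.
have Y_0 : Y = 0.
  apply: (@cyclic_eq0 Y (fun k => X k u)) => //; last by rewrite e0.
  by move=> k m; apply: X_inside.
split=> //; apply: X_eq0; first have := E x1; last have := E x2.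
all: by rewrite Y_0 mul0mx mulmx0 subr0 addr0.
Qed.

End Tangent.

(** * Codimension of the border basis scheme *)

Lemma gen_ideal_enum_val (R : comNzRingType) (I : finType) (P : pred I) (f : I -> R) :
  same_ideal (gen_ideal P f)
    (gen_ideal xpredT (fun i : 'I_#|P| => f (enum_val i))).
Proof.
move=> x; split=> -[a ->].
  apply: big_ind => [||i Pi]; [exact: gen_ideal0 | exact: gen_idealD |].
  apply: gen_idealM; rewrite -(enum_rankK_in Pi Pi).
  exact: (@gen_ideal_mem _ _ xpredT (fun j : 'I_#|P| => f (enum_val j))).
apply: big_ind => [||i _]; [exact: gen_ideal0 | exact: gen_idealD |].
by apply: gen_idealM; apply: gen_ideal_mem; apply: (enum_valP i).
Qed.

(** At the generic point of [P] the columns of the Jacobian are gradients of elements of [P], so its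
    rank is a lower bound for the height. *)
Lemma height_ge_border_basis (K : fieldType) (mu nu : nat)
    (t : mu.-tuple 'X_{1..2}) (b : nu.-tuple 'X_{1..2})
    (P : prime_idealr {mpoly K[mu * nu]}) n :
  order_ideal t -> is_border t b -> prime_over (border_basis_ideal K t b) P ->
  (n + mu * 2 = nu * mu)%N -> height_ge P n.
Proof.
move=> tO bO IP nE; have [F [phi phiE]] := prime_residue_field P.
have phi_rho pq : phi (rho K t b pq) = 0.
  by apply/eqP; rewrite -phiE; apply: IP; apply: gen_ideal_mem.
have [m [W [hP WP]]] :=
  gradients_bound_height_mpoly (d_derivation phi) (phiE : P =i rker phi).
apply: height_geW hP; rewrite -(leq_add2r (mu * 2)) nE mulnC.
apply: leq_trans (rank_jacobian tO bO phi_rho) _; rewrite leq_add2r -mxrank_tr.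
suff /mxrankS/leq_trans : ((jacobian t b phi)^T <= W)%MS by apply; apply: rank_leq_row.
apply/row_subP=> k; case/mxvec_indexP: k => p q.
have := WP (rho K t b (p, q)); rewrite phiE phi_rho eqxx => /(_ isT).
by congr (_ <= _)%MS; apply/rowP=> k; rewrite !mxE mxvecE [RHS]mxE.
Qed.

Theorem theorem11p4 (K : fieldType) (charK0 : [pchar K] =i pred0)
    (mu nu : nat) (t : mu.-tuple 'X_{1..2}) (b : nu.-tuple 'X_{1..2})
    (tO : order_ideal t) (bO : is_border t b) :
  [/\ same_ideal (border_basis_ideal K t b) (gen_ideal (kept t) (rho K t b)),
      #|kept t|%:Z = (nu%:Z - 2) * mu%:Z :> int
    & complete_intersection (border_basis_ideal K t b)].
Proof.
have cardE := card_kept tO bO.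
have gen := border_basis_ideal_kept b tO charK0.
have gen' x := iff_trans (gen x) (gen_ideal_enum_val (kept t) (rho K t b) x).
split=> //; first by lia.
exists #|kept t|, (fun i => rho K t b (enum_val i)); split=> //; split.
  by move=> P IP; apply: (height_ge_border_basis tO bO IP).
(* The kept [rho]'s vanish at the origin, so some prime over the ideal has height at most their
   number. *)
have [i|P IP hP] := @exists_prime_height_leq (mu * nu) K #|kept t|
  (fun i => rho K t b (enum_val i)); first exact: rho_coef0.
by exists P => // x /gen' /IP.
Qed.
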